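(* Let $\mathbb{G}$ be a stratified group, let $0\le\rho\in C^1(\mathbb{G})$ and let $2\le p<\infty$. Let $0\le F\in C^\infty(\mathbb{G})$ and $0\le\eta\in L^1_{loc}(\mathbb{G})$ be such that $$\eta F^{p-1}\le-\mathcal{L}_{p,\rho}F\quad\text{a.e. in }\mathbb{G}.$$ Then we have $$\|\eta^{1/p}f\|_{L^p(\mathbb{G})}^p+C_p\left\|\rho^{1/p}F\,\nabla_H\frac fF\right\|_{L^p(\mathbb{G})}^p\le\|\rho^{1/p}\nabla_Hf\|_{L^p(\mathbb{G})}^p$$ for all real-valued functions $f\in C_0^\infty(\mathbb{G})$. Here $C_p$ is a positive constant.
   Context: A stratified group (homogeneous Carnot group) is a Lie group $\mathbb{G}=(\mathbb{R}^n,\circ)$ such that: (a) for some natural numbers $N=N_1,N_2,\dots,N_r$ with $N_1+\dots+N_r=n$, writing $\mathbb{R}^n=\mathbb{R}^{N}\times\mathbb{R}^{N_2}\times\dots\times\mathbb{R}^{N_r}$, for every $\lambda>0$ the dilation $\delta_\lambda(x',x^{(2)},\dots,x^{(r)})=(\lambda x',\lambda^2x^{(2)},\dots,\lambda^r x^{(r)})$ is an automorphism of $\mathbb{G}$, where $x'\in\mathbb{R}^N$ and $x^{(k)}\in\mathbb{R}^{N_k}$; (b) if $X_1,\dots,X_N$ are the left-invariant vector fields on $\mathbb{G}$ with $X_k(0)=\partial/\partial x'_k|_0$, then the iterated commutators of $X_1,\dots,X_N$ span the Lie algebra of $\mathbb{G}$ (rank $n$ at every point). $\nabla_H=(X_1,\dots,X_N)$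 is the horizontal gradient, $|\nabla_H f|=(\sum_k|X_kf|^2)^{1/2}$, and $\mathrm{div}_Hv=\sum_{k=1}^NX_kv_k$. The weighted $p$-sub-Laplacian is $\mathcal{L}_{p,\rho}F=\mathrm{div}_H(\rho(x)|\nabla_HF|^{p-2}\nabla_HF)$. $L^p(\mathbb{G})$ is with respect to Lebesgue measure $dx$ on $\mathbb{R}^n$ (the Haar measure of $\mathbb{G}$); the norm of a vector-valued function is that of its Euclidean length. $C_0^\infty(\mathbb{G})$ denotes smooth compactly supported functions.
   Formalization: The formal theorem additionally assumes F > 0 almost everywhere: with F = 0 and η a large constant the hypotheses hold, yet f/F is undefined and the claimed inequality fails. *)

(* Defs.v *)
From HB Require Import structures.
From mathcomp Require Import all_boot all_order all_algebra.
From mathcomp Require Import all_classical all_reals all_analysis.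

Set Implicit Arguments.
Unset Strict Implicit.
Unset Printing Implicit Defensive.

Import Order.TTheory GRing.Theory Num.Theory.
Import numFieldNormedType.Exports.

Local Open Scope classical_set_scope.
Local Open Scope ring_scope.

(** * Lebesgue measure on R^n

    R^n is ['rV[R]_n].  As the library does for [n.-tuple T], it is given the
    sigma-algebra generated by the coordinates, which is the Borel one. *)

Definition rV_display : measure_display. Proof. exact: (default_measure_display). Qed.

Section rV_measurable.
Context (R : realType) (n : nat).

Let coord (i : 'I_n) (x : 'rV[R]_n) : measurableTypeR R := x 0 i.

Let rV_set0 : g_sigma_preimage coord set0.
Proof. exact: sigma_algebra0. Qed.

Let rV_setC A : g_sigma_preimage coord A -> g_sigma_preimage coord (~` A).
Proof. exact: sigma_algebraC. Qed.

Let rV_bigcup (F : (set 'rV[R]_n)^nat) :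
  (forall i, g_sigma_preimage coord (F i)) ->
  g_sigma_preimage coord (\bigcup_i (F i)).
Proof. exact: sigma_algebra_bigcup. Qed.

HB.instance Definition _ := @isMeasurable.Build rV_display
  'rV[R]_n (g_sigma_preimage coord) rV_set0 rV_setC rV_bigcup.

Lemma measurable_rV_coord (i : 'I_n) :
  measurable_fun [set: 'rV[R]_n] (fun x => x 0 i : measurableTypeR R).
Proof.
move=> _ Y mY; rewrite setTI; apply: sub_sigma_algebra => /=.
rewrite -bigcup_seq/=; exists i => /=; first by rewrite mem_index_enum.
by exists Y => //; rewrite setTI.
Qed.

Lemma measurable_fun_rVP d (T : measurableType d) (f : T -> 'rV[R]_n) :
  (forall i, measurable_fun [set: T] (fun t => f t 0 i : measurableTypeR R)) ->
  measurable_fun [set: T] f.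
Proof.
move=> mf _ A mA; rewrite setTI; move: A mA.
have -> : @measurable _ 'rV[R]_n = g_sigma_preimage coord by [].
rewrite /g_sigma_preimage.
set G := (X in <<s X >>).
have sG : sigma_algebra [set: 'rV[R]_n] [set A | measurable (f @^-1` A)].
  split => /=.
  - by rewrite preimage_set0.
  - by move=> A mA; rewrite setTD; exact: measurableC.
  - by move=> F mF; rewrite preimage_bigcup; exact: bigcupT_measurable.
apply: smallest_sub => //.
rewrite /G -bigcup_seq => A [i _ [B mB <-]] /=.
rewrite setTI -[X in measurable X]setTI.
exact: (mf i measurableT B mB).
Qed.

End rV_measurable.

Section lebesgue_rV.
Context {R : realType}.

Definition rV_cons n (p : measurableTypeR R * 'rV[R]_n) : 'rV[R]_n.+1 :=
  \row_i oapp (p.2 0) (p.1 : R) (unlift ord0 i).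

Lemma measurable_rV_cons n :
  measurable_fun [set: (measurableTypeR R * 'rV[R]_n)%type] (@rV_cons n).
Proof.
apply: measurable_fun_rVP => i.
under eq_fun do rewrite mxE.
case: (unliftP ord0 i) => [j ij|i0] /=.
  apply: (measurableT_comp (@measurable_rV_coord R n j)).
  exact: measurable_snd.
exact: measurable_fst.
Qed.

Definition rV_uncons n (x : 'rV[R]_n.+1) : measurableTypeR R * 'rV[R]_n :=
  (x 0 ord0, \row_j x 0 (lift ord0 j)).

Lemma rV_consK n : cancel (@rV_cons n) (@rV_uncons n).
Proof.
move=> [a v]; rewrite /rV_uncons /rV_cons; congr pair.
  by rewrite mxE unlift_none.
by apply/rowP => j; rewrite !mxE liftK.
Qed.

Lemma measurable_rV_uncons n : measurable_fun [set: 'rV[R]_n.+1] (@rV_uncons n).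
Proof.
apply/measurable_fun_pairP; split; first exact: measurable_rV_coord.
apply: measurable_fun_rVP => i.
by under eq_fun do rewrite /= mxE; apply: measurable_rV_coord.
Qed.

Section step.
Context n (mu : {sigma_finite_measure set 'rV[R]_n -> \bar R}).

Definition lebesgue_rV_step : set 'rV[R]_n.+1 -> \bar R :=
  pushforward (@lebesgue_measure R \x mu)%E (@rV_cons n).

HB.instance Definition _ := Measure.copy lebesgue_rV_step
  (measure_function_pushforward__canonical__measure_function_Measure
     (@lebesgue_measure R \x mu)%E (@measurable_rV_cons n)).

Let step_sigma_finite : sigma_finite setT lebesgue_rV_step.
Proof.
have /sigma_finiteP[F [TF ndF Foo]] := sigma_finiteT (@lebesgue_measure R).
have /sigma_finiteP[G [TG ndG Goo]] := sigma_finiteT mu.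
exists (fun k => @rV_uncons n @^-1` (F k `*` G k)).
  rewrite -preimage_bigcup; apply/esym; rewrite -[RHS](@preimage_setT _ _ (@rV_uncons n)).
  congr (_ @^-1` _); rewrite -setXTT TF TG predeqE => -[x y]; split.
    by move=> [k _ []/= ? ?]; split; exists k.
  move=> [/= [k _ Fx] [l _ Gy]]; exists (maxn k l) => //; split.
  - by move: x Fx; exact/subsetPset/ndF/leq_maxl.
  - by move: y Gy; exact/subsetPset/ndG/leq_maxr.
move=> k; have [mF Fk] := Foo k; have [mG Gk] := Goo k; split.
  rewrite -[X in measurable X]setTI; apply: measurable_rV_uncons => //.
  exact: measurableX.
rewrite /lebesgue_rV_step /pushforward -comp_preimage.
rewrite (_ : @rV_uncons n \o @rV_cons n = id); last first.
  by apply/funext => x /=; rewrite rV_consK.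
by rewrite preimage_id product_measure1E// lte_mul_pinfty// ge0_fin_numE.
Qed.

HB.instance Definition _ := Measure_isSigmaFinite.Build _ _ _
  lebesgue_rV_step step_sigma_finite.

End step.

Fixpoint lebesgue_rV n : {sigma_finite_measure set 'rV[R]_n -> \bar R} :=
  match n with
  | 0%N => \d_(0 : 'rV[R]_0)
  | n'.+1 => lebesgue_rV_step (lebesgue_rV n')
  end.

(* This property characterizes Lebesgue measure. *)
Lemma lebesgue_rV_box n (A : 'I_n -> set (measurableTypeR R)) :
  (forall i, measurable (A i)) ->
  lebesgue_rV n [set x | forall i, A i (x 0 i)] =
    (\prod_(i < n) lebesgue_measure (A i))%E.
Proof.
elim: n A => [|n IH] A mA /=.
  by rewrite big_ord0 diracE mem_set// => -[].
rewrite /lebesgue_rV_step /pushforward.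
rewrite [X in (_ \x _)%E X](_ : _ =
  A ord0 `*` [set y : 'rV[R]_n | forall i, A (lift ord0 i) (y 0 i)]).
  rewrite product_measure1E//; last first.
    rewrite (_ : [set y | _] = \big[setI/setT]_(i < n)
      ((fun y : 'rV[R]_n => y 0 i : measurableTypeR R) @^-1` A (lift ord0 i))).
      apply: bigsetI_measurable => i _.
      rewrite -[X in measurable X]setTI.
      exact: (@measurable_rV_coord R n i).
    apply/seteqP; split=> y /=.
      by move=> Ay; rewrite -bigcap_seq => i _ /=; exact: Ay.
    by rewrite -bigcap_seq => Ay i; apply: Ay => /=; rewrite mem_index_enum.
  by rewrite big_ord_recl -(IH (fun i => A (lift ord0 i))).
apply/seteqP; split=> -[a y] /=.
  move=> Ay; split; first by have := Ay ord0; rewrite mxE unlift_none.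
  by move=> i; have := Ay (lift ord0 i); rewrite mxE liftK.
move=> [Aa Ay] i; rewrite mxE; case: unliftP => [j ->|->] //=; exact: Ay.
Qed.

End lebesgue_rV.

(** * Calculus *)

(* When [V] is finite-dimensional this is the usual class C^k: [f] is C^k.+1
   iff it is differentiable and its partial derivatives are C^k. *)
Fixpoint Ck (R : realType) (V W : normedModType R) (k : nat) (f : V -> W)
    : Prop :=
  match k with
  | 0%N => continuous f
  | k'.+1 => (forall x, differentiable f x) /\ forall v, Ck k' ('D_v f)
  end.

Definition smooth (R : realType) (V W : normedModType R) (f : V -> W) : Prop :=
  forall k, Ck k f.

Definition compactly_supported (R : realType) (V : normedModType R)
    (f : V -> R) : Prop :=
  compact (closure [set x | f x != 0]).

(* [`|v|] is the sup norm on ['rV[R]_m]. *)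
Definition enorm (R : realType) (m : nat) (v : 'rV[R]_m) : R :=
  Num.sqrt (\sum_i v 0 i ^+ 2).

Definition loc_integrable (R : realType) (n : nat) (g : 'rV[R]_n -> R) : Prop :=
  measurable_fun [set: 'rV[R]_n] (g : _ -> measurableTypeR R) /\
  forall K : set 'rV[R]_n, compact K ->
    (\int[lebesgue_rV n]_(x in K) `|g x|%:E < +oo)%E.

(* A vector field [sum_i a_i d/dx_i] is the map [x |-> (a_i x)_i], and it acts
   on functions by [f |-> (x |-> 'D_(X x) f x)]. *)
Definition vfield (R : realType) (n : nat) := 'rV[R]_n -> 'rV[R]_n.

(* Coefficients of the commutator [X Y - Y X] of the two derivations. *)
Definition vbracket (R : realType) (n : nat) (X Y : vfield R n) : vfield R n :=
  fun x => 'D_(X x) Y x - 'D_(Y x) X x.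

Inductive iterated_commutator (R : realType) (n m : nat)
    (X : 'I_m -> vfield R n) : vfield R n -> Prop :=
  | IterComm1 k : iterated_commutator X (X k)
  | IterCommS k Z :
      iterated_commutator X Z -> iterated_commutator X (vbracket (X k) Z).

(** * Stratified groups *)

Record lie_group (R : realType) (n : nat) := LieGroup {
  lg_mul : 'rV[R]_n -> 'rV[R]_n -> 'rV[R]_n;
  lg_one : 'rV[R]_n;
  lg_inv : 'rV[R]_n -> 'rV[R]_n;
  lg_mulA : associative lg_mul;
  lg_mul1 : left_id lg_one lg_mul;
  lg_mulr1 : right_id lg_one lg_mul;
  lg_mulV : left_inverse lg_one lg_inv lg_mul;
  lg_mulrV : right_inverse lg_one lg_inv lg_mul;
  lg_mul_smooth : smooth (fun z : 'rV[R]_n * 'rV[R]_n => lg_mul z.1 z.2);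
  lg_inv_smooth : smooth lg_inv
}.

Definition left_invariant (R : realType) (n : nat) (G : lie_group R n)
    (X : vfield R n) : Prop :=
  forall x y, X (lg_mul G x y) = 'd (lg_mul G x) y (X y).

(* The coordinates are split into consecutive layers of sizes [N :: Ns];
   [weight] is the 1-based index of the layer of a coordinate. *)
Definition weight (N : nat) (Ns : seq nat) (i : nat) : nat :=
  (reshape_index (N :: Ns) i).+1.

Definition dilation (R : realType) (N : nat) (Ns : seq nat) (l : R)
    (x : 'rV[R]_(N + sumn Ns)) : 'rV[R]_(N + sumn Ns) :=
  \row_i (l ^+ weight N Ns i * x 0 i).
Arguments dilation {R} N Ns l x.

(* Dilations by [l > 0] are smooth bijections, so being automorphisms amounts
   to being multiplicative. *)
Record stratified_group (R : realType) (N : nat) (Ns : seq nat) :=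
    StratifiedGroup {
  sg_group :> lie_group R (N + sumn Ns);
  sg_layers_gt0 : all (leq 1) (N :: Ns);
  sg_dilation : forall l : R, 0 < l ->
    {morph dilation N Ns l : x y / lg_mul sg_group x y};
  hfield : 'I_N -> vfield R (N + sumn Ns);
  hfield_left_invariant : forall k, left_invariant sg_group (hfield k);
  hfield_at0 : forall k, hfield k 0 = delta_mx 0 (lshift (sumn Ns) k);
  hfield_rank : forall x, exists Z : 'I_(N + sumn Ns) -> vfield R (N + sumn Ns),
    (forall i, iterated_commutator hfield (Z i)) /\
    \rank (\matrix_i Z i x) = (N + sumn Ns)%N
}.

Section horizontal.
Context (R : realType) (N : nat) (Ns : seq nat) (G : stratified_group R N Ns).
Local Notation V := 'rV[R]_(N + sumn Ns).

Definition hgrad (f : V -> R) (x : V) : 'rV[R]_N :=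
  \row_k 'D_(hfield G k x) f x.

Definition hdiv (v : V -> 'rV[R]_N) (x : V) : R :=
  \sum_k 'D_(hfield G k x) (fun y => v y 0 k) x.

Definition sub_laplacian (p : R) (rho : V -> R) (F : V -> R) : V -> R :=
  hdiv (fun x => (rho x * enorm (hgrad F x) `^ (p - 2)) *: hgrad F x).

End horizontal.

(* Main.v *)
Require Import Defs.
From mathcomp Require Import all_boot all_order all_algebra.
From mathcomp Require Import all_classical all_reals all_analysis.
From mathcomp Require Import measurable_realfun ring lra.

(** The inequality is Picone's inequality integrated against the supersolution [F].

    Write [X_k] for the horizontal fields, [grad] for the horizontal gradient and
    [C = 2^(1-p)]. Uniform convexity of [|.|^p] for [p >= 2],
    [|a|^p + p |a|^(p-2) a.b + C |b|^p <= |a + b|^p] ([enorm_uniformly_convex]),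
    used with [a = (f / F) grad F] and [b = F grad (f / F)], whose sum is [grad f],
    gives the pointwise inequality ([picone])
      [|grad F|^(p-2) grad F . grad (|f|^p F^(1-p)) + C |F grad (f / F)|^p
        <= |grad f|^p].
    Multiply it by [rho] and integrate. Integration by parts moves the gradient of
    the test function [T = |f|^p F^(1-p)] onto the flux
    [rho |grad F|^(p-2) grad F], and the supersolution inequality bounds minus the
    divergence of the flux from below by [eta F^(p-1)], whose product with [T] is
    [eta |f|^p].

    Since [F] may vanish on a null set, [F] is replaced by [F + e] in [T] and in
    the remainder but not in the flux: [grad (F + e) = grad F], so the argument is
    unchanged ([integral_regularized_density]), and Fatou's lemma removes [e]
    ([integral_limit_density]).

    Integration by parts needs two facts. The horizontal fields are divergence
    free ([hfield_partial_eq0]): by left invariance [X_k] is a derivative of the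
    group law, so dilations make its [j]-th coefficient homogeneous of degree
    [weight j - 1], and its [j]-th partial derivative, homogeneous of degree [-1]
    and continuous at the origin, is zero. And the flux is continuously
    differentiable even where [grad F] vanishes
    ([C1_gradient_sqnorm_powR_mul]). Differentiability is used in the form of
    directional derivatives with a continuous gradient ([C1_gradient]), which is
    what the fundamental theorem of calculus on lines and Fubini's theorem ask
    for ([integral_partial_eq0]). *)

Set Implicit Arguments.
Unset Strict Implicit.
Unset Printing Implicit Defensive.

Import Order.TTheory GRing.Theory Num.Theory.
Import numFieldNormedType.Exports.

Local Open Scope classical_set_scope.
Local Open Scope ring_scope.

(** * A uniform convexity inequality *)

(** Young's inequality for [x] and [y^(q - 1)]. *)
Lemma powR_tangent (R : realType) (q x y : R) : 1 <= q -> 0 <= x -> 0 <= y ->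
  y `^ q + q * y `^ (q - 1) * (x - y) <= x `^ q.
Proof.
move=> q1 x0 y0; have q0 : 0 < q by exact: lt_le_trans q1.
have [->|qn1] := eqVneq q 1; first by rewrite subrr powRr0 !powRr1//; lra.
have q1' : 0 < q - 1 by rewrite subr_gt0 lt_neqAle eq_sym qn1.
have conj : q^-1 + (q / (q - 1))^-1 = 1 by field; rewrite !gt_eqF.
have := conjugate_powR x0 (powR_ge0 y (q - 1)) q0 (divr_gt0 q0 q1') conj.
rewrite -powRrM (_ : (q - 1) * (q / (q - 1)) = q); last first.
  by field; rewrite gt_eqF.
move=> /(ler_wpM2l (ltW q0)).
rewrite (_ : q * (_ + _) = x `^ q + (q - 1) * y `^ q); last first.
  by field; rewrite !gt_eqF.
by have := mulr_powRB1 y0 q0; nra.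
Qed.

Lemma powR_midpoint (R : realType) (q x y : R) : 1 <= q -> 0 <= x -> 0 <= y ->
  2 * ((x + y) / 2) `^ q <= x `^ q + y `^ q.
Proof.
move=> q1 x0 y0; have m0 : 0 <= (x + y) / 2 by lra.
by have := powR_tangent q1 x0 m0; have := powR_tangent q1 y0 m0; nra.
Qed.

Lemma powR_superadditive (R : realType) (q x y : R) :
  1 <= q -> 0 <= x -> 0 <= y -> x `^ q + y `^ q <= (x + y) `^ q.
Proof.
move=> q1 x0 y0; have q0 : 0 < q by exact: lt_le_trans q1.
have xy0 : 0 <= x + y by exact: addr_ge0.
rewrite -!(mulr_powRB1 _ q0)// mulrDl.
have le t : 0 <= t -> t <= x + y -> t `^ (q - 1) <= (x + y) `^ (q - 1).
  by move=> t0; apply: ge0_ler_powR; rewrite ?nnegrE// subr_ge0.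
by apply: lerD; apply: ler_wpM2l => //; apply: le => //; rewrite ?lerDl ?lerDr.
Qed.

Definition sqnorm (R : realType) m (v : 'rV[R]_m) : R := \sum_i v 0 i ^+ 2.
Definition dotp (R : realType) m (u v : 'rV[R]_m) : R := \sum_i u 0 i * v 0 i.

Lemma sqnorm_ge0 (R : realType) m (v : 'rV[R]_m) : 0 <= sqnorm v.
Proof. by apply: sumr_ge0 => i _; exact: sqr_ge0. Qed.

Lemma sqnorm_dotp (R : realType) m (v : 'rV[R]_m) : sqnorm v = dotp v v.
Proof. by apply: eq_bigr => i _; rewrite expr2. Qed.

Lemma enorm_powR (R : realType) m (v : 'rV[R]_m) r :
  enorm v `^ r = sqnorm v `^ (r / 2).
Proof. by rewrite /enorm -powR12_sqrt ?sqnorm_ge0// -powRrM mulrC. Qed.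

Lemma enormZ (R : realType) m (c : R) (v : 'rV[R]_m) :
  enorm (c *: v) = `|c| * enorm v.
Proof.
rewrite /enorm -sqrtr_sqr -sqrtrM ?sqr_ge0//; congr Num.sqrt.
by rewrite mulr_sumr; apply: eq_bigr => i _; rewrite mxE exprMn.
Qed.

Lemma sqnormD (R : realType) m (u v : 'rV[R]_m) (t : R) :
  sqnorm (u + t *: v) = sqnorm u + t * 2 * dotp u v + t ^+ 2 * sqnorm v.
Proof.
rewrite /sqnorm /dotp !mulr_sumr -!big_split/=; apply: eq_bigr => i _.
by rewrite !mxE; ring.
Qed.

(** Clarkson's inequality applied to the midpoint [a + b / 2] bounds
    [|a + b|^p + |a|^p] from below by [2 |a + b / 2|^p + 2 |b / 2|^p], and the
    tangent inequality at [a] bounds [|a + b / 2|^p]; the remainder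
    [2 |b / 2|^p] gives the constant [2^(1 - p)]. *)
Lemma enorm_uniformly_convex (R : realType) (p : R) m (a b : 'rV[R]_m) :
  2 <= p ->
  enorm a `^ p + p * enorm a `^ (p - 2) * dotp a b +
    2 `^ (1 - p) * enorm b `^ p <= enorm (a + b) `^ p.
Proof.
move=> p2; rewrite !enorm_powR; set q := p / 2.
have q1 : 1 <= q by rewrite /q; lra.
have q0 : 0 < q by exact: lt_le_trans q1.
rewrite (_ : (p - 2) / 2 = q - 1); last by rewrite /q; field.
have A0 := sqnorm_ge0 a; have B0 := sqnorm_ge0 b.
have X0 := sqnorm_ge0 (a + b); have M0 := sqnorm_ge0 (a + 2^-1 *: b).
have EX : sqnorm (a + b) = sqnorm a + 2 * dotp a b + sqnorm b.
  by rewrite -[b in LHS]scale1r sqnormD; ring.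
have EM := sqnormD a b 2^-1.
have B40 : 0 <= sqnorm b / 4 by apply: divr_ge0.
have := powR_midpoint q1 X0 A0.
rewrite (_ : (sqnorm (a + b) + sqnorm a) / 2 =
  sqnorm (a + 2^-1 *: b) + sqnorm b / 4); last by rewrite EX EM; field.
have := powR_superadditive q1 M0 B40.
have := powR_tangent q1 M0 A0.
have -> : (sqnorm b / 4) `^ q = 2 `^ (1 - p) / 2 * sqnorm b `^ q.
  rewrite powRM// mulrC; congr (_ * _).
  rewrite (_ : 4^-1 = 2 `^ (- 2%:R)) ; last by rewrite powR_invn// -natrX.
  rewrite -powRrM (_ : - 2 * q = 1 - p - 1); last by rewrite /q; field.
  by rewrite powRB ?pnatr_eq0 ?implybT// powRr1.
have Aq0 := powR_ge0 (sqnorm a) (q - 1).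
have qAB0 : 0 <= q * sqnorm a `^ (q - 1) * (sqnorm b / 4).
  by apply: mulr_ge0 => //; exact: mulr_ge0 (ltW q0) Aq0.
have -> : sqnorm (a + 2^-1 *: b) - sqnorm a = dotp a b + sqnorm b / 4.
  by rewrite EM; field.
have -> : p = 2 * q by rewrite /q; field.
rewrite mulrDr; lra.
Qed.

(** * Continuous functions and Lebesgue measure on R^n *)

Section measurability.
Context (R : realType) (n : nat).
Local Notation V := 'rV[R]_n.

Lemma measurable_rV_box (A : 'I_n -> set (measurableTypeR R)) :
  (forall i, measurable (A i)) -> measurable [set x : V | forall i, A i (x 0 i)].
Proof.
move=> mA; rewrite (_ : [set x | _] = \big[setI/setT]_(i < n)
    ((fun x : V => x 0 i : measurableTypeR R) @^-1` A i)).
  apply: bigsetI_measurable => i _; rewrite -[X in measurable X]setTI.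
  exact: (@measurable_rV_coord R n i).
apply/seteqP; split=> y /=; rewrite -bigcap_seq => Ay i.
  by move=> _; exact: Ay.
by apply: Ay => /=; rewrite mem_index_enum.
Qed.

(** The sigma-algebra is generated by the coordinates, so an open set has to be
    written as a countable union of boxes; rational corners do. *)
Lemma open_measurable_rV (A : set V) : open A -> measurable A.
Proof.
move=> oA; pose box (qr : 'rV[rat]_n * 'rV[rat]_n) : set V :=
  [set x | forall i, `]ratr (qr.1 0 i), ratr (qr.2 0 i)[%classic (x 0 i)].
pose F qr := if `[< box qr `<=` A >] then box qr else set0.
have -> : A = \bigcup_qr F qr.
  apply/seteqP; split=> [x Ax|x [qr _]]; last first.
    by rewrite /F; case: asboolP => // sub; exact: sub.
  have := open_nbhs_nbhs (conj oA Ax); rewrite -nbhs_ballE => -[e /= e0 xeA].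
  have /boolp.choice[q qP] i : exists q : rat, ratr q \in `]x 0 i - e, x 0 i[.
    by apply: rat_in_itvoo; rewrite ltrBlDr ltrDl.
  have /boolp.choice[r rP] i : exists r : rat, ratr r \in `]x 0 i, x 0 i + e[.
    by apply: rat_in_itvoo; rewrite ltrDl.
  exists (\row_i q i, \row_i r i) => //; rewrite /F; case: asboolP => [_|].
    move=> i /=; rewrite !mxE in_itv/=.
    by have := qP i; have := rP i; rewrite !in_itv/= => /andP[-> _] /andP[_ ->].
  case=> y /= yqr; apply: xeA; split=> // j i; rewrite ord1 /ball/=.
  have := yqr i; rewrite /= !mxE in_itv/=; have := qP i; have := rP i.
  rewrite !in_itv/= ltr_norml => /andP[? ?] /andP[? ?] /andP[? ?].
  by apply/andP; split; lra.
apply: countable_bigcupT_measurable; first exact: countableP.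
move=> qr; rewrite /F; case: asboolP => // _.
exact: (@measurable_rV_box (fun i => `]ratr (qr.1 0 i), ratr (qr.2 0 i)[%classic)).
Qed.

Lemma continuous_measurable_rV (f : V -> R) : continuous f ->
  measurable_fun [set: V] (f : _ -> measurableTypeR R).
Proof.
move=> /continuousP cf; apply: (measurability _ (RGenOpens.measurableE R)).
move=> _ [_ [a [b ->] <-]]; rewrite setTI; apply: open_measurable_rV.
exact/cf/interval_open.
Qed.

Definition box_supported (M : R) (u : V -> R) :=
  forall (x : V) i, M < `|x 0 i| -> u x = 0.

Lemma bounded_rV_box (M : R) : bounded_set [set x : V | forall i, `|x 0 i| <= M].
Proof.
exists `|M|; split; first exact: num_real.
move=> B MB x xM; rewrite /= /Num.norm/= mx_normrE.
apply: bigmax_le => [|[j i] _] /=.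
  by apply: le_trans (ltW MB); exact: normr_ge0.
by rewrite ord1 (le_trans (xM i))// (le_trans (ler_norm _)) ?ltW.
Qed.

Lemma closed_rV_box (M : R) : closed [set x : V | forall i, `|x 0 i| <= M].
Proof.
rewrite (_ : [set x | _] = \bigcap_i [set x : V | `|x 0 i| <= M]); last first.
  by apply/seteqP; split=> x /= xM i //=; exact: (xM i).
apply: closed_bigI => i _.
apply: (@preimage_closed _ _ (fun x : V => `|x 0 i|) [set t | t <= M]); last first.
  exact: closed_le.
move=> x _; apply: (@continuous_comp _ _ _ (fun x : V => x 0 i) (@Num.norm R R)).
  exact: coord_continuous.
exact: norm_continuous.
Qed.

Lemma integrable_box_supported (M : R) (u : V -> R) :
  continuous u -> box_supported M u ->
  (lebesgue_rV n).-integrable [set: V] (EFin \o u).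
Proof.
move=> cu su; pose B : set V := [set x | forall i, `[- M, M]%classic (x 0 i)].
have BE : B = [set x | forall i, `|x 0 i| <= M].
  by apply/seteqP; split=> x /= xM i; have := xM i; rewrite /= in_itv/= ler_norml.
have mB : measurable B by exact: (@measurable_rV_box (fun=> `[- M, M]%classic)).
have mu' : measurable_fun [set: V] u by exact: continuous_measurable_rV.
have -> : EFin \o u = (EFin \o u) \_ B.
  apply/funext => x /=; rewrite patchE; case: ifPn => // /negP xB.
  apply/congr1; apply: contrapT => ux; apply: xB; rewrite inE BE => i /=.
  by rewrite leNgt; apply/negP => /(su x i).
apply: (integrable_mkcond _ mB).1; apply: measurable_bounded_integrable => //.
- rewrite [X in (X < _)%E](_ : _ = (\prod_(i < n)
      lebesgue_measure (`[(- M)%R, M]%classic : set (measurableTypeR R)))%E); last first.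
    exact: (@lebesgue_rV_box R n (fun=> `[- M, M]%classic)).
  rewrite -ge0_fin_numE; last by apply: prode_ge0.
  apply: prode_fin_num => i _; rewrite lebesgue_measure_itv/=.
  by case: ifP.
- exact: measurable_funTS.
- rewrite /= BE; have cB : compact [set x : V | forall i, `|x 0 i| <= M].
    by apply: bounded_closed_compact; [exact: bounded_rV_box|exact: closed_rV_box].
  have [K [_ KP]] := compact_bounded
    (continuous_compact (continuous_subspaceT cu) cB).
  exists K; split; first exact: num_real.
  by move=> r Kr x Bx; apply: KP => //; exists x.
Qed.

End measurability.

(** * Integrals of partial derivatives *)

Lemma continuous_rV (T : topologicalType) (R : realType) n (f : T -> 'rV[R]_n) :
  (forall i, continuous (fun x => f x 0 i)) -> continuous f.
Proof.
move=> cf x; apply/cvgrPdist_le => /= e e0.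
near=> y; rewrite /Num.norm/= mx_normrE; apply: bigmax_le; first exact: ltW.
move=> [j i] _ /=; rewrite !mxE ord1; move: i; near: y.
apply: filter_forall => i.
by have /cvgrPdist_le/(_ e e0) := cf i x.
Unshelve. all: by end_near. Qed.

(** A directional derivative only involves the restriction to a line, so it can
    be transported between functions that agree along a pair of lines. *)
Lemma is_derive_line (R : realType) (V V' W : normedModType R) (f : V -> W)
    (g : V' -> W) (x v : V) (x' v' : V') (d : W) :
  (forall h : R, f (h *: v + x) = g (h *: v' + x')) ->
  is_derive x v f d -> is_derive x' v' g d.
Proof.
move=> fg; have f0g0 : f x = g x'.
  by have := fg 0; rewrite !scale0r !add0r.
have E : (fun h : R => h^-1 *: ((f \o shift x) (h *: v) - f x)) =
         (fun h => h^-1 *: ((g \o shift x') (h *: v') - g x')).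
  by apply/funext => h /=; rewrite f0g0 fg.
by case=> df fd; split; [rewrite /derivable -E|rewrite /derive -E].
Qed.

Lemma integral_derive1_eq0 (R : realType) (M : R) (u d : R -> R) :
  (forall t : R, is_derive t 1 u (d t)) -> continuous d ->
  (forall t, M < `|t| -> u t = 0) -> (forall t, M < `|t| -> d t = 0) ->
  (\int[lebesgue_measure]_t (d t)%:E = 0)%E.
Proof.
move=> ud cd su sd; pose K := `|M| + 1.
have K0 : 0 < K by rewrite ltr_wpDl.
have MK : M < K by rewrite (le_lt_trans (ler_norm _))// ltrDl.
have cu : continuous u.
  move=> t; have [ut _] := ud t.
  exact/differentiable_continuous/derivable1_diffP.
transitivity (\int[lebesgue_measure]_(t in `[(- K)%R, K]) (d t)%:E)%E.
  rewrite [RHS]integral_mkcond; apply: eq_integral => t _; rewrite patchE.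
  case: ifPn => //; rewrite notin_setE/= in_itv/= -ler_norml => /negP.
  by rewrite -ltNge => Kt; rewrite sd// (lt_trans MK).
rewrite (continuous_FTC2 (F := u)).
- by rewrite !su ?normrN ?gtr0_norm// subee.
- by rewrite gtrN.
- exact: continuous_subspaceT.
- split; first by move=> t _; have [] := ud t.
  + exact/cvg_at_right_filter/cu.
  + exact/cvg_at_left_filter/cu.
- by move=> t _; rewrite derive1E; have [_ ->] := ud t.
Qed.

Section fubini.
Context (R : realType) (n : nat) (g : 'rV[R]_n.+1 -> R)
  (ig : (lebesgue_rV n.+1).-integrable [set: 'rV[R]_n.+1] (EFin \o g)).

Let h (z : measurableTypeR R * 'rV[R]_n) : \bar R := (g (rV_cons z))%:E.

Let mg : measurable_fun [set: 'rV[R]_n.+1] (EFin \o g : _ -> \bar R).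
Proof. exact: measurable_int ig. Qed.

Let ih : (@lebesgue_measure R \x lebesgue_rV n)%E.-integrable setT h.
Proof.
apply/integrableP; split.
  exact: (measurableT_comp mg (@measurable_rV_cons R n)).
have /integrableP[_] := ig; apply: le_lt_trans.
rewrite [leRHS](@ge0_integral_pushforward _ _ _ _ R _ (@measurable_rV_cons R n)
  (@lebesgue_measure R \x lebesgue_rV n)%E [set: 'rV[R]_n.+1])//.
exact: measurableT_comp.
Qed.

Let E : (\int[lebesgue_rV n.+1]_x (g x)%:E =
         \int[@lebesgue_measure R \x lebesgue_rV n]_z h z)%E.
Proof.
exact: (@integral_pushforward _ _ _ _ R _ (@measurable_rV_cons R n)
  (@lebesgue_measure R \x lebesgue_rV n)%E setT (EFin \o g) mg ih measurableT).
Qed.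

Lemma integral_lebesgue_rVS_head_first :
  (\int[lebesgue_rV n.+1]_x (g x)%:E =
   \int[lebesgue_rV n]_y \int[lebesgue_measure]_a (g (rV_cons (a, y)))%:E)%E.
Proof. by rewrite E -(integral21_prod_meas1 ih). Qed.

Lemma integral_lebesgue_rVS_tail_first :
  (\int[lebesgue_rV n.+1]_x (g x)%:E =
   \int[lebesgue_measure]_a \int[lebesgue_rV n]_y (g (rV_cons (a, y)))%:E)%E.
Proof. by rewrite E -(integral12_prod_meas1 ih). Qed.

End fubini.

Lemma rV_cons_lift (R : realType) n (a : R) (y : 'rV[R]_n) i :
  rV_cons (a, y) 0 (lift ord0 i) = y 0 i.
Proof. by rewrite mxE liftK. Qed.

Lemma rV_cons0 (R : realType) n (a : R) (y : 'rV[R]_n) :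
  rV_cons (a, y) 0 ord0 = a.
Proof. by rewrite mxE unlift_none. Qed.

(** Fubini peels off the head variable. If [j] is the head, integrate it first, by
    the fundamental theorem of calculus; otherwise integrate it last, the inner
    integral over the tail being zero by induction. *)
Lemma integral_partial_eq0 (R : realType) n (j : 'I_n) (M : R)
    (u d : 'rV[R]_n -> R) :
  (forall x, is_derive x (delta_mx 0 j) u (d x)) -> continuous d ->
  box_supported M u -> box_supported M d ->
  (\int[lebesgue_rV n]_x (d x)%:E = 0)%E.
Proof.
elim: n j u d => [[] //|n IHn j u d ud cd su sd].
have id := integrable_box_supported cd sd.
case: (unliftP ord0 j) => [k jk|j0].
- rewrite integral_lebesgue_rVS_tail_first//.
  rewrite integral0_eq// => a _.
  apply: (IHn k (fun y => u (rV_cons (a, y)))).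
  + move=> y; apply: is_derive_line (ud (rV_cons (a, y))) => h.
    congr u; apply/rowP => i; rewrite !mxE jk.
    case: unliftP => [i' ->|->] /=; last by rewrite mulr0 add0r.
    by rewrite !mxE (inj_eq (@lift_inj _ _)).
  + move=> y; apply: continuous_comp; last exact: cd.
    apply: continuous_rV => i; case: (unliftP ord0 i) => [i' ->|->].
      by under eq_fun do rewrite rV_cons_lift; exact: coord_continuous.
    by under eq_fun do rewrite rV_cons0; exact: cst_continuous.
  + by move=> y i; rewrite -(rV_cons_lift a y i); exact: su.
  + by move=> y i; rewrite -(rV_cons_lift a y i); exact: sd.
- rewrite integral_lebesgue_rVS_head_first//.
  rewrite integral0_eq// => y _.
  apply: (@integral_derive1_eq0 _ M (fun a => u (rV_cons (a, y)))).
  + move=> a; apply: is_derive_line (ud (rV_cons (a, y))) => h.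
    congr u; apply/rowP => i; rewrite !mxE j0.
    case: unliftP => [i' ->|->] /=; rewrite ?eqxx//.
    by rewrite mulr0 add0r.
  + move=> a; apply: (@continuous_comp _ _ _ (fun a : R => rV_cons (a, y))); last exact: cd.
    apply: continuous_rV => i; case: (unliftP ord0 i) => [i' ->|->].
      by under eq_fun do rewrite rV_cons_lift; exact: cst_continuous.
    by under eq_fun do rewrite rV_cons0.
  + by move=> a; rewrite -{1}(rV_cons0 a y); exact: su.
  + by move=> a; rewrite -{1}(rV_cons0 a y); exact: sd.
Qed.

(** * Calculus with directional derivatives *)

Section rules.
Context (R : realType) (V : normedModType R).
Implicit Types (q w s : V -> R) (x v : V).

Lemma is_derive_chain (phi : R -> R) s x v (a d : R) :
  is_derive (s x) 1 phi a -> is_derive x v s d ->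
  is_derive x v (fun y => phi (s y)) (a * d).
Proof.
move=> dphi ds; pose l (h : R) := s (h *: v + x).
have dl : is_derive (0 : R) 1 l d.
  by apply: is_derive_line ds => h; rewrite /l addr0 [h *: 1]mulr1.
have dphi' : is_derive (l 0) 1 phi a by rewrite /l scale0r add0r.
have := is_derive1_comp dphi' dl.
by apply: is_derive_line => h; rewrite /l /= addr0 [h *: 1]mulr1.
Qed.

(** At a zero of [w] only the continuity of the other factor is needed. This is
    what makes [|u|^r u] differentiable at the zeros of [u], where [|u|^r] need
    not be. *)
Lemma is_derive_mul_zero q w x v (d : R) :
  {for x, continuous q} -> w x = 0 -> is_derive x v w d ->
  is_derive x v (fun y => q y * w y) (q x * d).
Proof.
move=> cq wx0 [dw wd].
suff E : (fun h : R => h^-1 *: (((fun y => q y * w y) \o shift x) (h *: v)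
    - q x * w x)) @ 0^' --> q x * d.
  by split; [apply/cvg_ex; exists (q x * d)|exact: (cvg_lim _ E)].
have -> : (fun h : R => h^-1 *: (((fun y => q y * w y) \o shift x) (h *: v)
    - q x * w x)) =
  (fun h : R => q (h *: v + x) * (h^-1 *: ((w \o shift x) (h *: v) - w x))).
  by apply/funext => h /=; rewrite wx0 mulr0 !subr0; exact: mulrCA.
apply: cvgM; last by rewrite -wd; exact: dw.
apply: (@cvg_comp _ _ _ (fun h : R => h *: v + x) q _ (nbhs x)); last exact: cq.
have cl : {for 0, continuous (fun h : R => h *: v + x)}.
  apply: cvgD; last exact: cvg_cst.
  by apply: cvgZr_tmp; exact: cvg_id.
have := cl; rewrite /prop_for /continuous_at scale0r add0r.
by apply: cvg_trans; apply: cvg_app; exact: cvg_within.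
Qed.

End rules.

Lemma continuous_powR (R : realType) (T : topologicalType) (s : T -> R) (r : R) :
  0 <= r -> (forall x, 0 <= s x) -> continuous s ->
  continuous (fun x => s x `^ r).
Proof.
rewrite le_eqVlt => /predU1P[<- _ _|r0 s0 cs x].
  by under eq_fun do rewrite powRr0; exact: cst_continuous.
have [sx0|sx0] := ltP 0 (s x).
  apply: (@continuous_comp _ _ _ s (fun t => t `^ r)); first exact: cs.
  apply/differentiable_continuous/derivable1_diffP.
  by have [] := is_derive1_powR r sx0.
have {sx0} sx : s x = 0 by apply/eqP; rewrite eq_le sx0 s0.
apply/cvgrPdist_lt => e e0; rewrite sx powR0 ?gt_eqF//.
have := cs x; move/cvgrPdist_lt => /(_ (e `^ r^-1) (powR_gt0 _ e0)).
rewrite sx; apply: filterS => y; rewrite !sub0r !normrN !ger0_norm ?powR_ge0//.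
move=> /(gt0_ltr_powR r0); rewrite -powRrM mulVf ?gt_eqF// powRr1 ?ltW//.
by apply; rewrite nnegrE ?powR_ge0.
Qed.

Lemma continuous_dotp (R : realType) (T : topologicalType) m (a b : T -> 'rV[R]_m) :
  continuous a -> continuous b -> continuous (fun x => dotp (a x) (b x)).
Proof.
move=> ca cb; move=> x; apply: cvg_big => [|i _]; first exact: add_continuous.
apply: cvgM.
  exact: (@continuous_comp _ _ _ a (fun v => v 0 i) x (ca x) (@coord_continuous _ _ _ _ _ _)).
exact: (@continuous_comp _ _ _ b (fun v => v 0 i) x (cb x) (@coord_continuous _ _ _ _ _ _)).
Qed.

Section dotp_linear.
Context (R : realType) (m : nat).
Implicit Types (u v w : 'rV[R]_m).

Lemma dotpDl u v w : dotp (u + v) w = dotp u w + dotp v w.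
Proof. by rewrite -big_split; apply: eq_bigr => i _; rewrite mxE mulrDl. Qed.

Lemma dotpZl (c : R) u v : dotp (c *: u) v = c * dotp u v.
Proof. by rewrite mulr_sumr; apply: eq_bigr => i _; rewrite mxE mulrA. Qed.

Lemma dotpC u v : dotp u v = dotp v u.
Proof. by apply: eq_bigr => i _; rewrite mulrC. Qed.

Lemma dotp_suml I (s : seq I) (F : I -> 'rV[R]_m) v :
  dotp (\sum_(i <- s) F i) v = \sum_(i <- s) dotp (F i) v.
Proof.
elim: s => [|i s IH]; last by rewrite !big_cons dotpDl IH.
by rewrite !big_nil /dotp big1// => i _; rewrite mxE mul0r.
Qed.

Lemma dotp_delta u j : dotp u (delta_mx 0 j) = u 0 j.
Proof.
rewrite /dotp (bigD1 j)//= mxE !eqxx mulr1 big1 ?addr0// => i ij.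
by rewrite mxE (negbTE ij) mulr0.
Qed.

End dotp_linear.

Section C1_gradient.
Context (R : realType) (n : nat).
Local Notation V := 'rV[R]_n.
Implicit Types (w : V -> R) (g : V -> V).

(** Continuously differentiable with gradient [g]. Asking for directional
    derivatives only loses nothing, since [g] is continuous, and reduces every
    rule to calculus in one variable. *)
Definition C1_gradient w g :=
  [/\ continuous w, continuous g & forall x v, is_derive x v w (dotp (g x) v)].

Lemma C1_gradient_derive w g x v : C1_gradient w g -> 'D_v w x = dotp (g x) v.
Proof. by case=> _ _ /(_ x v)[]. Qed.

Lemma eq_C1_gradient w w' g : w =1 w' -> C1_gradient w g -> C1_gradient w' g.
Proof. by move=> /funext ->. Qed.

Lemma Ck1_C1_gradient w : Ck 1 w ->
  C1_gradient w (fun x => \row_j 'D_(delta_mx 0 j) w x).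
Proof.
move=> [dw cw]; split.
- by move=> x; exact/differentiable_continuous.
- by apply: continuous_rV => j; under eq_fun do rewrite mxE; exact: cw.
- move=> x v; split; first exact: diff_derivable.
  rewrite deriveE// {1}(row_sum_delta v) linear_sum/=; apply: eq_bigr => j _.
  by rewrite linearZ/= mxE -deriveE// mulrC.
Qed.

Lemma C1_gradientM w1 g1 w2 g2 : C1_gradient w1 g1 -> C1_gradient w2 g2 ->
  C1_gradient (fun x => w1 x * w2 x) (fun x => w1 x *: g2 x + w2 x *: g1 x).
Proof.
move=> [cw1 cg1 d1] [cw2 cg2 d2]; split.
- by move=> x; exact: (cvgM (cw1 x) (cw2 x)).
- move=> x.
  exact: (cvgD (cvgZ (cw1 x) (cg2 x)) (cvgZ (cw2 x) (cg1 x))).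
- move=> x v; rewrite dotpDl !dotpZl.
  exact: (is_deriveM (d1 x v) (d2 x v)).
Qed.

Lemma C1_gradient_sum I (s : seq I) (w : I -> V -> R) (g : I -> V -> V) :
  (forall i, C1_gradient (w i) (g i)) ->
  C1_gradient (fun x => \sum_(i <- s) w i x) (fun x => \sum_(i <- s) g i x).
Proof.
move=> wg; elim: s => [|i s [cw cg d]].
  under [fun x => \sum_(i <- [::]) w i x]eq_fun do rewrite big_nil.
  under [fun x => \sum_(i <- [::]) g i x]eq_fun do rewrite big_nil.
  split; try exact: cst_continuous.
  by move=> x v; rewrite /dotp big1 => [|i _]; [exact: is_derive_cst|rewrite mxE mul0r].
under [fun x => \sum_(j <- i :: s) w j x]eq_fun do rewrite big_cons.
under [fun x => \sum_(j <- i :: s) g j x]eq_fun do rewrite big_cons.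
have [cwi cgi di] := wg i; split.
- by move=> x; exact: (cvgD (cwi x) (cw x)).
- by move=> x; exact: (cvgD (cgi x) (cg x)).
- by move=> x v; rewrite dotpDl; exact: (is_deriveD (di x v) (d x v)).
Qed.

Lemma C1_gradient_powR w g (r : R) : (forall x, 0 < w x) -> C1_gradient w g ->
  C1_gradient (fun x => w x `^ r) (fun x => (r * w x `^ (r - 1)) *: g x).
Proof.
move=> w0 [cw cg d].
have c t : continuous (fun x => w x `^ t).
  move=> x; apply: (@continuous_comp _ _ _ w (fun y => y `^ t)); first exact: cw.
  apply/differentiable_continuous/derivable1_diffP.
  by have [] := is_derive1_powR t (w0 x).
split; first exact: c.
- by move=> x; exact: (cvgZ (cvgM (cvg_cst r) (c (r - 1) x)) (cg x)).
- by move=> x v; rewrite dotpZl; exact: is_derive_chain (is_derive1_powR r (w0 x)) _.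
Qed.

End C1_gradient.

Lemma continuous_at_squeeze0 (R : realType) (T : topologicalType)
    (w b : T -> R) (x : T) :
  (forall y, `|w y| <= b y) -> b x = 0 -> continuous_at x b -> continuous_at x w.
Proof.
move=> wb bx0 cb; have wx0 : w x = 0 by apply/eqP; rewrite -normr_le0 -bx0.
rewrite /continuous_at wx0; apply/cvgrPdist_lt => e e0.
have := cb; move/cvgrPdist_lt => /(_ e e0); rewrite bx0; apply: filterS => y.
rewrite !sub0r !normrN (@ger0_norm _ (b y)); first exact: le_lt_trans.
exact: le_trans (normr_ge0 _) (wb y).
Qed.

Lemma sqr_powR (R : realType) (t r : R) : (t ^+ 2) `^ (r / 2) = `|t| `^ r.
Proof.
by rewrite -real_normK ?num_real// -powR_mulrn// -powRrM mulrCA mulfV ?mulr1.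
Qed.

Section power_rules.
Context (R : realType) (n : nat).
Local Notation V := 'rV[R]_n.

(** Away from the zeros of [f], differentiate [(f^2)^(p/2)]; at a zero, see
    [|f|^p] as the continuous [|f|^(p-2) f] times [f]. *)
Lemma C1_gradient_norm_powR (f : V -> R) gf (p : R) : 2 <= p ->
  C1_gradient f gf ->
  C1_gradient (fun x => `|f x| `^ p)
    (fun x => (p * (`|f x| `^ (p - 2) * f x)) *: gf x).
Proof.
move=> p2 Cf; have [cf cgf df] := Cf.
have cn r : 0 <= r -> continuous (fun x => `|f x| `^ r).
  move=> r0; apply: continuous_powR => // x.
  exact: (@continuous_comp _ _ _ f (@Num.norm R R) x (cf x) (@norm_continuous _ R _)).
have p20 : 0 <= p - 2 by rewrite subr_ge0.
have cq : continuous (fun x => `|f x| `^ (p - 2) * f x).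
  by move=> x; exact: (cvgM (cn _ p20 x) (cf x)).
split; first by apply: cn; lra.
  by move=> x; exact: (cvgZ (cvgM (cvg_cst p) (cq x)) (cgf x)).
move=> x v; rewrite dotpZl; have [fx0|fx0] := eqVneq (f x) 0.
  have := is_derive_mul_zero (cq x) fx0 (df x v).
  have -> : (fun y => `|f y| `^ (p - 2) * f y * f y) = (fun y => `|f y| `^ p).
    apply/funext => y; rewrite -mulrA -expr2 -real_normK ?num_real//.
    rewrite -powR_mulrn// -powRD ?subrK//; apply/implyP => p0; exfalso.
    by move: p0; apply/negP; rewrite gt_eqF//; lra.
  by rewrite fx0 !mulr0 mul0r.
have f2 : 0 < (f ^+ 2) x by rewrite [X in _ < X](_ : _ = f x ^+ 2)// exprn_even_gt0.
have := is_derive_chain (is_derive1_powR (p / 2) f2) (is_deriveX 2 (df x v)).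
have -> : (fun y => (f ^+ 2) y `^ (p / 2)) = (fun y => `|f y| `^ p).
  by apply/funext => y; rewrite -sqr_powR.
move=> D; apply: (is_derive_eq D).
rewrite (_ : p / 2 - 1 = (p - 2) / 2); last by field.
by rewrite sqr_powR /GRing.scale/= expr1; field.
Qed.

Section vector_powers.
Context (m : nat) (U : V -> 'rV[R]_m) (gU : 'I_m -> V -> V)
  (CU : forall i, C1_gradient (fun x => U x 0 i) (gU i)).

Lemma C1_gradient_sqnorm :
  C1_gradient (fun x => sqnorm (U x))
    (fun x => \sum_i (2 * U x 0 i) *: gU i x).
Proof.
apply: C1_gradient_sum => i; have := C1_gradientM (CU i) (CU i).
under eq_fun do rewrite -expr2.
by under [fun x => _ + _]eq_fun do rewrite -scalerDl -mulr2n -mulr_natl.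
Qed.

Lemma normM_le_sqnorm (v : 'rV[R]_m) k i : `|v 0 k * v 0 i| <= sqnorm v.
Proof.
have le j : v 0 j ^+ 2 <= sqnorm v.
  rewrite /sqnorm (bigD1 j)//= lerDl; apply: sumr_ge0 => *; exact: sqr_ge0.
have := le k; have := le i; rewrite normrM.
have := sqr_ge0 (`|v 0 k| - `|v 0 i|); rewrite sqrrB !real_normK ?num_real//.
by move: (sqnorm v) (v 0 k ^+ 2) (v 0 i ^+ 2) (`|v 0 k| * `|v 0 i|) => *; lra.
Qed.

(** The factor [|U|^(2r - 2)] is singular at the origin when [r < 1], but it is
    compensated by the quadratic factor. *)
Lemma continuous_sqnorm_powR_quadratic (r : R) k i : 0 < r ->
  continuous (fun x => sqnorm (U x) `^ (r - 1) * (U x 0 k * U x 0 i)).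
Proof.
move=> r0; have [cs _ _] := C1_gradient_sqnorm.
have cU j : continuous (fun x => U x 0 j) by have [] := CU j.
move=> x; have [s0|s0] := ltP 0 (sqnorm (U x)).
  suff c1 : continuous_at x (fun y => sqnorm (U y) `^ (r - 1)).
    exact: (cvgM c1 (cvgM (cU k x) (cU i x))).
  apply: (@continuous_comp _ _ _ (fun y => sqnorm (U y)) (fun t => t `^ (r - 1))).
    exact: cs.
  apply/differentiable_continuous/derivable1_diffP.
  by have [] := is_derive1_powR (r - 1) s0.
have {s0} sx : sqnorm (U x) = 0 by apply/eqP; rewrite eq_le s0 sqnorm_ge0.
have b y : `|sqnorm (U y) `^ (r - 1) * (U y 0 k * U y 0 i)| <= sqnorm (U y) `^ r.
  rewrite normrM ger0_norm ?powR_ge0// -(mulr_powRB1 (sqnorm_ge0 _) r0) mulrC.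
  by apply: ler_wpM2r; [exact: powR_ge0|exact: normM_le_sqnorm].
have cr := continuous_powR (ltW r0) (fun x => sqnorm_ge0 (U x)) cs.
apply: (continuous_at_squeeze0 b); last exact: cr.
by rewrite sx powR0 ?gt_eqF.
Qed.

(** With [U] the gradient of [F] and [r = (p - 2) / 2], this is the regularity of
    the flux [|U|^(p-2) U] of the [p]-Laplacian, also where [U] vanishes. There
    the second term of the gradient is zero, so the formula needs no case. *)
Lemma C1_gradient_sqnorm_powR_mul (r : R) k : 0 <= r ->
  C1_gradient (fun x => sqnorm (U x) `^ r * U x 0 k)
    (fun x => sqnorm (U x) `^ r *: gU k x +
       \sum_i (2 * r * (sqnorm (U x) `^ (r - 1) * (U x 0 k * U x 0 i))) *: gU i x).
Proof.
move=> r0; have [cs _ ds] := C1_gradient_sqnorm; have [cU cgU dU] := CU k.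
have cr := continuous_powR r0 (fun x => sqnorm_ge0 (U x)) cs.
split.
- by move=> x; exact: (cvgM (cr x) (cU x)).
- suff S : continuous (fun x =>
       \sum_i (2 * r * (sqnorm (U x) `^ (r - 1) * (U x 0 k * U x 0 i))) *: gU i x).
    by move=> x; exact: (cvgD (cvgZ (cr x) (cgU x)) (S x)).
  apply: continuous_big => [|i _ x]; first exact: add_continuous.
  have [_ cg _] := CU i; suff c : continuous_at x (fun x =>
      2 * r * (sqnorm (U x) `^ (r - 1) * (U x 0 k * U x 0 i))).
    exact: (cvgZ c (cg x)).
  move: r0; rewrite le_eqVlt => /predU1P[<-|r0].
    by under eq_fun do rewrite mulr0 mul0r; exact: cst_continuous.
  exact: (cvgM (cvg_cst (2 * r)) (@continuous_sqnorm_powR_quadratic r k i r0 x)).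
- move=> x v; rewrite dotpDl dotpZl dotp_suml.
  have [s0|s0] := ltP 0 (sqnorm (U x)).
    have ch := @is_derive_chain _ _ _ (fun x => sqnorm (U x)) x v _ _
      (is_derive1_powR r s0) (ds x v).
    have := is_deriveM ch (dU x v).
    move=> D; apply: (is_derive_eq D).
    congr (_ + _); rewrite dotp_suml /GRing.scale/= mulr_sumr mulr_sumr.
    by apply: eq_bigr => i _; rewrite !dotpZl; ring.
  have {s0} sx : sqnorm (U x) = 0 by apply/eqP; rewrite eq_le s0 sqnorm_ge0.
  have Uj j : U x 0 j = 0.
    apply/eqP; rewrite -sqrf_eq0 eq_le sqr_ge0 andbT -sx.
    by rewrite expr2 (le_trans (ler_norm _))// normM_le_sqnorm.
  rewrite [X in _ + X]big1 ?addr0; last first.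
    by move=> i _; rewrite dotpZl Uj mul0r !mulr0 mul0r.
  exact: is_derive_mul_zero (cr x) (Uj k) (dU x v).
Qed.

End vector_powers.
End power_rules.

(** * Divergence-free fields *)

Lemma box_supported_gradient (R : realType) n (M : R) (w : 'rV[R]_n -> R) g :
  C1_gradient w g -> box_supported M w ->
  forall (x : 'rV[R]_n) i, M < `|x 0 i| -> g x = 0.
Proof.
move=> [_ _ dw] sw x i Mx; apply/rowP => j; rewrite mxE -dotp_delta.
have [_ <-] := dw x (delta_mx 0 j); rewrite -(derive_cst (0 : R) x (delta_mx 0 j)).
apply: near_eq_derive.
have c : continuous_at x (fun y : 'rV[R]_n => `|y 0 i|).
  apply: (@continuous_comp _ _ _ (fun y : 'rV[R]_n => y 0 i) (@Num.norm R R)).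
    exact: coord_continuous.
  exact: norm_continuous.
near=> y; apply: (sw y i); near: y.
exact: (cvgr_gt _ c _ Mx).
Unshelve. all: by end_near. Qed.

(** A divergence-free derivation of [u] is a sum of partial derivatives, namely
    [X u = \sum_j d_j (X_j u)]. *)
Lemma integral_divergence_free (R : realType) n (M : R)
    (X : 'rV[R]_n -> 'rV[R]_n) (gX : 'I_n -> 'rV[R]_n -> 'rV[R]_n)
    (u : 'rV[R]_n -> R) gu :
  (forall j, C1_gradient (fun x => X x 0 j) (gX j)) ->
  (forall x, \sum_j gX j x 0 j = 0) ->
  C1_gradient u gu -> box_supported M u ->
  (\int[lebesgue_rV n]_x (dotp (gu x) (X x))%:E = 0)%E.
Proof.
move=> CX div0 Cu su; have sg := box_supported_gradient Cu su.
pose d j x := (X x 0 j *: gu x + u x *: gX j x) 0 j.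
have Cd j := C1_gradientM (CX j) Cu.
have cd j : continuous (d j).
  have [_ cg _] := Cd j => x.
  exact: (@continuous_comp _ _ _ _ (fun v : 'rV[R]_n => v 0 j) x (cg x)
    (@coord_continuous _ _ _ _ _ _)).
have sd j : box_supported M (d j).
  by move=> x i Mx; rewrite /d (sg x i Mx) (su x i Mx) scaler0 scale0r addr0 mxE.
have dE x : (dotp (gu x) (X x))%:E = (\sum_j (d j x)%:E)%E.
  rewrite sumEFin; congr EFin.
  transitivity (dotp (gu x) (X x) + u x * \sum_j gX j x 0 j).
    by rewrite div0 mulr0 addr0.
  rewrite /dotp mulr_sumr -big_split/=; apply: eq_bigr => j _.
  by rewrite /d !mxE mulrC.
under eq_integral do rewrite dE.
rewrite integral_sum//; last first.
  by move=> j; exact: integrable_box_supported (cd j) (sd j).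
rewrite big1// => j _.
apply: (integral_partial_eq0 (j := j)
  (u := fun x => X x 0 j * u x) _ (cd j) _ (sd j)); last first.
  by move=> x i Mx; rewrite (su x i Mx) mulr0.
move=> x; have [_ _ /(_ x (delta_mx 0 j))] := Cd j.
by rewrite dotp_delta.
Qed.

(** * Horizontal fields of a stratified group *)

Section stratified.
Context (R : realType) (N : nat) (Ns : seq nat) (G : stratified_group R N Ns).
Local Notation V := 'rV[R]_(N + sumn Ns).
Local Notation e k := (delta_mx 0 (lshift (sumn Ns) k) : V).
Implicit Types (x y : V) (k : 'I_N).

Lemma lg_idempotent_one x : lg_mul G x x = x -> x = lg_one G.
Proof.
move=> xx; rewrite -[LHS](lg_mul1 G) -{1}(lg_mulV G x) -lg_mulA xx.
exact: lg_mulV.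
Qed.

(** The unit is fixed by dilations, which fix nothing but the origin. *)
Lemma sg_one : lg_one G = 0.
Proof.
have : dilation N Ns 2 (lg_one G) = lg_one G.
  by apply: lg_idempotent_one; rewrite -sg_dilation// lg_mul1.
move=> /rowP E; apply/rowP => i; have := E i; rewrite !mxE => /eqP.
rewrite -subr_eq0 -{2}[lg_one G 0 i]mul1r -mulrBl mulf_eq0 => /orP[|/eqP//].
by rewrite subr_eq0 pexpr_eq1 ?ler0n// => /eqP; lra.
Qed.

Lemma lg_mulr0 x : lg_mul G x 0 = x.
Proof. by rewrite -sg_one lg_mulr1. Qed.

Lemma weight_lshift k : weight N Ns (lshift (sumn Ns) k) = 1%N.
Proof.
by rewrite /weight /reshape_index /= subn_eq0 ltn_ord.
Qed.

Let mul2 (z : V * V) : V := lg_mul G z.1 z.2.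

Let mul_line x (h : R) y v : mul2 (h *: (0, v) + (x, y)) = lg_mul G x (h *: v + y).
Proof. by rewrite /mul2 /= scaler0 add0r. Qed.

Lemma differentiable_lg_mul x y : differentiable (lg_mul G x) y.
Proof.
have := lg_mul_smooth G 1 => -[dm _].
by apply: (differentiable_comp (f := fun y => (x, y)) (g := mul2)); first exact: differentiable_pair.
Qed.

(** Left invariance expresses [X_k] at [x] by the derivative of the group law at
    [(x, 0)], from which the regularity and homogeneity of [X_k] are read off. *)
Lemma hfieldE k x : hfield G k x = 'D_(e k) (lg_mul G x) 0.
Proof.
have := @hfield_left_invariant _ _ _ G k x 0; rewrite lg_mulr0 hfield_at0 => ->.
by rewrite deriveE//; exact: differentiable_lg_mul.
Qed.

Lemma is_derive_lg_mul k x : is_derive (0 : V) (e k) (lg_mul G x) (hfield G k x).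
Proof.
by rewrite hfieldE; split => //; exact/diff_derivable/differentiable_lg_mul.
Qed.

Lemma is_derive_coord (W : normedModType R) m (f : W -> 'rV[R]_m) (w v : W) d j :
  is_derive w v f d -> is_derive w v (fun t => f t 0 j) (d 0 j).
Proof.
case=> df <-; split; first exact: (derivable_mxP _ _ _).1.
by rewrite derive_mx// mxE.
Qed.

Lemma Ck1_hfield k j : Ck 1 (fun x => hfield G k x 0 j).
Proof.
have [_ /(_ (0, e k)) [dPsi cPsi]] := lg_mul_smooth G 2.
set Psi := 'D_(0, e k) _ in dPsi cPsi.
have E x : hfield G k x = Psi (x, 0).
  rewrite /Psi; symmetry.
  suff [_ ->] : is_derive (x, 0 : V) (0 : V, e k) mul2 (hfield G k x) by [].
  by apply: is_derive_line (is_derive_lg_mul k x) => h; rewrite mul_line.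
have dp x : differentiable (fun x : V => (x, 0 : V)) x by exact: differentiable_pair.
have -> : (fun x => hfield G k x 0 j) =
    (fun y : V => y 0 j) \o (Psi \o (fun x => (x, 0))).
  by apply/funext => x /=; rewrite E.
split=> [x|v].
  apply: differentiable_comp; last exact: differentiable_coord.
  exact: differentiable_comp.
have -> : 'D_v ((fun y : V => y 0 j) \o (Psi \o (fun x => (x, 0)))) =
    (fun x => 'D_(v, 0) Psi (x, 0) 0 j).
  apply/funext => x.
  have D : is_derive (x, 0 : V) (v, 0 : V) Psi ('D_(v, 0) Psi (x, 0)).
    by split => //; exact: diff_derivable.
  suff [] : is_derive x v (fun x => Psi (x, 0) 0 j) ('D_(v, 0) Psi (x, 0) 0 j) by [].
  apply: (is_derive_line _ (is_derive_coord j D)) => h /=.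
  congr (Psi _ 0 j); apply: injective_projections; rewrite /= ?scaler0 ?addr0//.
move=> x; apply: (@continuous_comp _ _ _ (fun x => 'D_(v, 0) Psi (x, 0))
  (fun y : V => y 0 j)).
  apply: (@continuous_comp _ _ _ (fun x : V => (x, 0 : V)) ('D_(v, 0) Psi)).
    exact: differentiable_continuous.
  exact: cPsi.
exact: coord_continuous.
Qed.

Definition hfield_gradient k j x : V :=
  \row_i 'D_(delta_mx 0 i) (fun x => hfield G k x 0 j) x.

Lemma C1_gradient_hfield k j :
  C1_gradient (fun x => hfield G k x 0 j) (hfield_gradient k j).
Proof. exact: Ck1_C1_gradient (Ck1_hfield k j). Qed.

(** Differentiate [(dilation x) (dilation y) = dilation (x y)] in [y] at the
    origin, in the direction of the horizontal coordinate [k], of weight 1. *)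
Lemma hfield_homogeneous k j x (l : R) : 0 < l ->
  l * hfield G k (dilation N Ns l x) 0 j = l ^+ weight N Ns j * hfield G k x 0 j.
Proof.
move=> l0.
have D1 : is_derive (0 : V) (l *: e k) (fun y => (lg_mul G (dilation N Ns l x) y) 0 j)
    (l * hfield G k (dilation N Ns l x) 0 j).
  set y := dilation N Ns l x; have dm := differentiable_lg_mul y 0.
  have : is_derive (0 : V) (l *: e k) (lg_mul G y) (l *: hfield G k y).
    split; first exact: diff_derivable.
    by rewrite hfieldE !deriveE// linearZ.
  by move=> /is_derive_coord-/(_ j); rewrite mxE.
have D2 := is_deriveZ (l ^+ weight N Ns j) (is_derive_coord j (is_derive_lg_mul k x)).
have [_ <-] := D1.
suff [_ <-] : is_derive (0 : V) (l *: e k)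
  (fun y => (lg_mul G (dilation N Ns l x) y) 0 j) (l ^+ weight N Ns j * hfield G k x 0 j) by [].
apply: is_derive_line D2 => h.
rewrite !addr0 /=.
have -> : h *: (l *: e k) = dilation N Ns l (h *: e k).
  apply/rowP => i; rewrite !mxE eqxx/=; have [->|] := eqVneq i; last by rewrite !mulr0.
  by rewrite weight_lshift expr1 mulrCA.
by rewrite -sg_dilation// mxE.
Qed.

(** The coefficient of [d_j] in [X_k] is homogeneous of degree [weight j - 1], so
    its derivative in the direction [j], of weight [weight j], is homogeneous of
    degree [-1]; being continuous at the origin, it vanishes. *)
Lemma hfield_partial_eq0 k j x : hfield_gradient k j x 0 j = 0.
Proof.
have [_ cg dg] := C1_gradient_hfield k j.
pose c y := hfield_gradient k j y 0 j.
have scale l : 0 < l -> c x = l * c (dilation N Ns l x).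
  move=> l0; set w := weight N Ns j.
  have D1 := is_deriveZ l (dg (dilation N Ns l x) (l ^+ w *: delta_mx 0 j)).
  have D1' : is_derive x (delta_mx 0 j)
      (fun y => l * hfield G k (dilation N Ns l y) 0 j)
      (l * dotp (hfield_gradient k j (dilation N Ns l x)) (l ^+ w *: delta_mx 0 j)).
    apply: is_derive_line D1 => h; congr (_ * hfield G k _ 0 j).
    apply/rowP => i; rewrite !mxE eqxx/= mulrDr; congr (_ + _).
    have [->|] := eqVneq i j; last by rewrite !mulr0.
    by rewrite mulrCA.
  have D2 := is_deriveZ (l ^+ w) (dg x (delta_mx 0 j)).
  have lw0 : l ^+ w != 0 by rewrite expf_neq0// gt_eqF.
  apply: (mulfI lw0); rewrite /c -dotp_delta -[LHS]/(l ^+ w *: _).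
  have [_ <-] := D2.
  rewrite [X in 'D_ _ X _](_ : _ =
    (fun y => l * hfield G k (dilation N Ns l y) 0 j)); last first.
    by apply/funext => y; rewrite hfield_homogeneous.
  have [_ ->] := D1'.
  by rewrite dotpC dotpZl dotpC dotp_delta mulrCA.
pose phi (l : R) := l * c (dilation N Ns l x).
have cphi : continuous phi.
  move=> l; apply: cvgM; first exact: cvg_id.
  apply: (@continuous_comp _ _ _ (fun l => dilation N Ns l x) c).
    apply: continuous_rV => i; under eq_fun do rewrite mxE.
    by move=> t; apply: cvgM; [exact: exprn_continuous|exact: cvg_cst].
  apply: (@continuous_comp _ _ _ (hfield_gradient k j) (fun v : V => v 0 j)).
    exact: cg.
  exact: coord_continuous.
have lim0 : phi @ 0^'+ --> (0 : R).
  by rewrite -[X in _ --> X](mul0r (c (dilation N Ns 0 x))); exact/cvg_at_right_filter/cphi.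
have limc : phi @ 0^'+ --> c x.
  have E : \forall l \near (0 : R)^'+, cst (c x) l = phi l.
    by near=> l; apply: scale; near: l; exact: nbhs_right_gt.
  exact: cvg_trans (near_eq_cvg E) (cvg_cst (c x)).
exact: (cvg_unique _ limc lim0).
Unshelve. all: by end_near. Qed.

Lemma integral_hfield (M : R) k (u : V -> R) gu :
  C1_gradient u gu -> box_supported M u ->
  (\int[lebesgue_rV (N + sumn Ns)]_x (dotp (gu x) (hfield G k x))%:E = 0)%E.
Proof.
apply: integral_divergence_free (fun j => C1_gradient_hfield k j) _ => x.
by rewrite big1// => j _; exact: hfield_partial_eq0.
Qed.

End stratified.

(** * Picone's inequality *)

(** With [a = (f / F) U] and [b = H - a], the pairing of [|U|^(p-2) U] with the
    gradient of [|f|^p F^(1-p)] is [|a|^p + p |a|^(p-2) a.b], the first-order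
    Taylor polynomial at [a] of [|.|^p] evaluated at [a + b = H]. *)
Lemma picone (R : realType) (p : R) m (U H : 'rV[R]_m) (f F : R) :
  2 <= p -> 0 < F ->
  enorm U `^ (p - 2) *
    dotp U ((`|f| `^ p * ((1 - p) * F `^ (1 - p - 1))) *: U +
            (F `^ (1 - p) * (p * (`|f| `^ (p - 2) * f))) *: H) +
  2 `^ (1 - p) * enorm (H - (f / F) *: U) `^ p <= enorm H `^ p.
Proof.
move=> p2 F0; have p0 : 0 < p by lra.
have := enorm_uniformly_convex ((f / F) *: U) (H - (f / F) *: U) p2.
rewrite subrKC; apply: le_trans; rewrite lerD2r.
have normpow (t : R) : `|t| `^ p = `|t| `^ (p - 2) * t ^+ 2.
  rewrite -real_normK ?num_real// -powR_mulrn// -powRD ?subrK//.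
  by apply/implyP => E; exfalso; move: E; apply/negP; rewrite gt_eqF//; lra.
have sqr : enorm U ^+ 2 = dotp U U.
  by rewrite sqr_sqrtr ?sqnorm_ge0// -sqnorm_dotp.
have eU0 : 0 <= enorm U by exact: sqrtr_ge0.
have eUp : enorm U `^ p = enorm U `^ (p - 2) * dotp U U.
  by rewrite -sqr -[in LHS](ger0_norm eU0) normpow ger0_norm.
rewrite !enormZ !powRM// eUp !normpow.
have -> : `|f / F| `^ (p - 2) = `|f| `^ (p - 2) * F `^ (2 - p).
  rewrite normrM powRM// normfV (gtr0_norm F0) -(powR_inv1 (ltW F0)) -powRrM.
  by congr (_ * _ `^ _); ring.
have F1 : F `^ (1 - p) = F `^ (2 - p) / F.
  rewrite -(powR_inv1 (ltW F0)) -powRD; last by rewrite (gt_eqF F0) implybT.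
  by congr (_ `^ _); ring.
have F2 : F `^ (1 - p - 1) = F `^ (2 - p) / F / F.
  by rewrite -F1 -(powR_inv1 (ltW F0)) -powRD// (gt_eqF F0) implybT.
rewrite F1 F2.
have -> : dotp ((f / F) *: U) (H - (f / F) *: U) =
    f / F * (dotp U H - f / F * dotp U U).
  by rewrite dotpZl dotpC dotpDl -scaleNr dotpZl mulNr dotpC.
rewrite dotpC dotpDl !dotpZl (dotpC H).
rewrite le_eqVlt; apply/orP; left; apply/eqP.
by field; rewrite gt_eqF.
Qed.

(** * Integral inequalities up to null sets *)

Section null_sets.
Context d (T : measurableType d) (R : realType)
  (mu : {measure set T -> \bar R}).

(** [J - t] is nonnegative only almost everywhere, so monotonicity is applied to
    [`|J - t|], which has the same integral as [J]. *)
Lemma integral_le_of_integral_eq0 (h J t : T -> R) :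
  measurable_fun [set: T] h -> (forall x, 0 <= h x) ->
  mu.-integrable [set: T] (EFin \o J) -> mu.-integrable [set: T] (EFin \o t) ->
  (\int[mu]_x (t x)%:E = 0)%E ->
  {ae mu, forall x, h x <= J x - t x} ->
  (\int[mu]_x (h x)%:E <= \int[mu]_x (J x)%:E)%E.
Proof.
move=> mh h0 iJ it t0 hJt.
have iJt := integrableB measurableT iJ it.
have mJt : measurable_fun [set: T] (fun x => (J x - t x)%:E).
  exact: measurable_int iJt.
have -> : (\int[mu]_x (J x)%:E = \int[mu]_x (`|J x - t x|)%:E)%E.
  transitivity (\int[mu]_x (J x - t x)%:E)%E.
    by rewrite (integralB_EFin measurableT iJ it) t0 sube0.
  apply: ae_eq_integral => //.
  - by apply/measurable_EFinP/measurableT_comp => //; exact/measurable_EFinP.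
  - by apply: filterS hJt => x hx _; rewrite ger0_norm// (le_trans (h0 x)).
apply: ae_ge0_le_integral => //.
- by move=> x _; rewrite lee_fin.
- exact/measurable_EFinP.
- by apply/measurable_EFinP/measurableT_comp => //; exact/measurable_EFinP.
- by apply: filterS hJt => x hx _; rewrite lee_fin (le_trans hx) ?ler_norm.
Qed.

(** Fatou's lemma with an almost everywhere limit. *)
Lemma integral_le_of_ae_cvg (h_ : nat -> T -> R) (h : T -> R) (c : \bar R) :
  (forall n, measurable_fun [set: T] (h_ n)) -> (forall n x, 0 <= h_ n x) ->
  measurable_fun [set: T] h -> (forall x, 0 <= h x) ->
  {ae mu, forall x, h_ ^~ x @ \oo --> h x} ->
  (forall n, (\int[mu]_x (h_ n x)%:E <= c)%E) ->
  (\int[mu]_x (h x)%:E <= c)%E.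
Proof.
move=> mh_ h_0 mh h0 cvgh hc.
have mE n : measurable_fun [set: T] (fun x => (h_ n x)%:E).
  exact/measurable_EFinP.
have E0 n x : [set: T] x -> (0 <= (h_ n x)%:E)%E by rewrite lee_fin.
have fat := fatou mu measurableT mE E0.
have le_c : (limn_einf (fun n => \int[mu]_x (h_ n x)%:E) <= c)%E.
  rewrite limn_einf_lim; apply: lime_le; first exact: is_cvg_einfs.
  by apply: nearW => n; apply: le_trans (hc n); apply: ereal_inf_lbound; exists n => /=.
apply: le_trans le_c; apply: le_trans fat; apply: ae_ge0_le_integral => //.
- by move=> x _; rewrite lee_fin.
- exact/measurable_EFinP.
- move=> x _; rewrite limn_einf_lim; apply: lime_ge; first exact: is_cvg_einfs.
  by apply: nearW => n; apply: le_ereal_inf_tmp => _ [k _ <-]; rewrite lee_fin.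
- apply: measurableT_comp => //; apply: measurable_fun_limn_esup => n.
  exact: measurableT_comp.
- apply: filterS cvgh => x cx _.
  have cx' : (fun n => (h_ n x)%:E) @ \oo --> (h x)%:E.
    by apply: cvg_EFin; [exact: nearW|exact: cx].
  by have [-> _] := cvg_limn_einf_sup cx'.
Qed.

End null_sets.

(** * The weak inequality and the limit *)

Lemma compactly_supported_box (R : realType) n (f : 'rV[R]_n -> R) :
  compactly_supported f -> exists M, box_supported M f.
Proof.
move=> /compact_bounded[M [_ bM]]; exists (M + 1) => x i xM.
apply: contrapT => fx.
have xle : `|x| <= M + 1.
  by apply: (bM (M + 1)); [rewrite ltrDl|apply: subset_closure; exact/eqP].
move: xM; apply/negP; rewrite -leNgt (le_trans _ xle)//.
rewrite /Num.norm/= mx_normrE.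
exact: (le_bigmax _ (fun ij : 'I_1 * 'I_n => `|x ij.1 ij.2|) (0, i)).
Qed.

Lemma measurable_fun_div d (T : measurableType d) (R : realType) (a b : T -> R) :
  measurable_fun [set: T] a -> measurable_fun [set: T] b ->
  (forall x, 0 <= b x) -> measurable_fun [set: T] (fun x => a x / b x).
Proof.
move=> ma mb b0; under eq_fun do rewrite -powR_inv1//.
by apply: measurable_funM => //; exact: (measurableT_comp (measurable_powR (-1)) mb).
Qed.

Lemma continuous_mulr_fun (R : realType) (T : topologicalType) (a b : T -> R) :
  continuous a -> continuous b -> continuous (fun x => a x * b x).
Proof. by move=> ca cb x; exact: (cvgM (ca x) (cb x)). Qed.

Section hardy.
Context (R : realType) (N : nat) (Ns : seq nat) (G : stratified_group R N Ns).
Local Notation V := 'rV[R]_(N + sumn Ns).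
Local Notation mu := (lebesgue_rV (N + sumn Ns)).

Lemma hgrad_dotp (w : V -> R) g (x : V) k : C1_gradient w g ->
  hgrad G w x 0 k = dotp (g x) (hfield G k x).
Proof. by move=> Cw; rewrite mxE; exact: C1_gradient_derive. Qed.

Lemma C1_gradient_hgrad (w : V -> R) k : smooth w ->
  exists g, C1_gradient (fun x => hgrad G w x 0 k) g.
Proof.
move=> sw; have Cw := Ck1_C1_gradient (sw 1); have [_ D2] := sw 2.
eexists; apply: (eq_C1_gradient (w := fun x =>
    \sum_j 'D_(delta_mx 0 j) w x * hfield G k x 0 j)).
  by move=> x; rewrite (hgrad_dotp _ _ Cw); apply: eq_bigr => j _; rewrite mxE.
apply: C1_gradient_sum => j.
exact: C1_gradientM (Ck1_C1_gradient (D2 _)) (C1_gradient_hfield G k j).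
Qed.

Context (p : R) (rho F f : V -> R) (M : R)
  (p2 : 2 <= p) (Crho : Ck 1 rho) (rho0 : forall x, 0 <= rho x)
  (sF : smooth F) (F0 : forall x, 0 <= F x)
  (sf : smooth f) (suppf : box_supported M f).

Let p_gt0 : 0 < p. Proof. exact: lt_le_trans p2. Qed.
Let Cf := Ck1_C1_gradient (sf 1).
Let CF := Ck1_C1_gradient (sF 1).

Lemma box_supported_hgrad (x : V) i : M < `|x 0 i| -> hgrad G f x = 0.
Proof.
move=> Mx; apply/rowP => k; rewrite (hgrad_dotp _ _ Cf) !mxE.
rewrite (box_supported_gradient Cf suppf Mx).
by rewrite /dotp big1// => j _; rewrite mxE mul0r.
Qed.

(** The horizontal divergence of [T rho |grad F|^(p-2) grad F], expanded by the
    product rule, where [T = |f|^p (F + e)^(1-p)] is the test function. *)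
Definition tested_flux_div (e : R) (x : V) : R :=
  rho x * (enorm (hgrad G F x) `^ (p - 2) * dotp (hgrad G F x)
    ((`|f x| `^ p * ((1 - p) * (F x + e) `^ (1 - p - 1))) *: hgrad G F x +
     ((F x + e) `^ (1 - p) * (p * (`|f x| `^ (p - 2) * f x))) *: hgrad G f x)) +
  `|f x| `^ p * (F x + e) `^ (1 - p) * sub_laplacian G p rho F x.

(** As a divergence with compact support it has integral zero, by
    [integral_hfield] applied to each component [u = W k * T] of the field. *)
Lemma integral_tested_flux_div (e : R) : 0 < e ->
  mu.-integrable [set: V] (EFin \o tested_flux_div e) /\
  (\int[mu]_x (tested_flux_div e x)%:E = 0)%E.
Proof.
move=> e0.
have /boolp.choice[gU CU] k := C1_gradient_hgrad k sF.
have r0 : 0 <= (p - 2) / 2 by apply: divr_ge0 => //; rewrite subr_ge0.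
pose W k x := rho x * (sqnorm (hgrad G F x) `^ ((p - 2) / 2) * hgrad G F x 0 k).
have /boolp.choice[gW CW] k : exists g, C1_gradient (W k) g.
  eexists; exact: C1_gradientM (Ck1_C1_gradient Crho)
    (C1_gradient_sqnorm_powR_mul CU k r0).
have CFe : C1_gradient (fun x => F x + e) (fun x => \row_j 'D_(delta_mx 0 j) F x).
  have [cF cg dF] := CF; split=> //.
    by move=> x; exact: (cvgD (cF x) (cvg_cst e)).
  by move=> x v; rewrite -[dotp _ _]addr0; exact: is_deriveD (dF x v) (is_derive_cst e x v).
have Fe0 x : 0 < F x + e by rewrite ltr_wpDl.
pose T x := `|f x| `^ p * (F x + e) `^ (1 - p).
have := C1_gradientM (C1_gradient_norm_powR p2 Cf) (C1_gradient_powR (1 - p) Fe0 CFe).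
set gT := (X in C1_gradient _ X) => CT.
have Cu k := C1_gradientM (CW k) CT.
have su k : box_supported M (fun x => W k x * T x).
  move=> x i Mx; rewrite /T (suppf Mx) normr0 powR0 ?mul0r ?mulr0//.
  by rewrite gt_eqF.
pose t k x := dotp (W k x *: gT x + T x *: gW k x) (hfield G k x).
have it k : mu.-integrable [set: V] (EFin \o t k).
  apply: (@integrable_box_supported _ _ M).
    apply: continuous_dotp; first by have [] := Cu k.
    by apply: continuous_rV => j; have [] := C1_gradient_hfield G k j.
  move=> x i Mx; rewrite /t (box_supported_gradient (Cu k) (su k) Mx).
  by rewrite /dotp big1// => j _; rewrite mxE mul0r.
have tE x : tested_flux_div e x = \sum_k t k x.
  rewrite /tested_flux_div /sub_laplacian /hdiv !mulr_sumr -big_split/=.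
  apply: eq_bigr => k _; rewrite /t dotpDl !dotpZl; congr (_ + _ * _).
    rewrite /W /gT dotpDl !dotpZl -(hgrad_dotp x k Cf) -(hgrad_dotp x k CF) enorm_powR.
    by rewrite !mxE; ring.
  rewrite -(C1_gradient_derive _ _ (CW k)); congr ('D_ _ _ x).
  by apply/funext => y; rewrite /W mxE enorm_powR mulrA.
split.
  under [X in integrable _ _ X]eq_fun do rewrite /= tE -sumEFin.
  by apply: integrable_sum => // k _; exact: it.
under eq_integral do rewrite tE -sumEFin.
rewrite integral_sum// big1// => k _.
exact: integral_hfield (Cu k) (su k).
Qed.

Let continuous_sqnorm_hgrad (w : V -> R) : smooth w ->
  continuous (fun x => sqnorm (hgrad G w x)).
Proof.
move=> sw; have /boolp.choice[g Cg] k := C1_gradient_hgrad k sw.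
by have [] := C1_gradient_sqnorm Cg.
Qed.

Let continuous_rho : continuous rho.
Proof. by have [] := Ck1_C1_gradient Crho. Qed.

Lemma integrable_energy :
  mu.-integrable [set: V] (EFin \o (fun x => rho x * enorm (hgrad G f x) `^ p)).
Proof.
have p20 : 0 <= p / 2 by rewrite divr_ge0// ltW.
apply: (@integrable_box_supported _ _ M) => [|x i Mx].
  have c := continuous_powR p20 (fun x => sqnorm_ge0 _) (continuous_sqnorm_hgrad sf).
  under eq_fun do rewrite enorm_powR.
  exact: continuous_mulr_fun continuous_rho c.
rewrite (box_supported_hgrad Mx) enorm_powR /sqnorm big1 => [|k _].
  by rewrite powR0 ?mulr0// gt_eqF// divr_gt0.
by rewrite mxE expr0n.
Qed.

(** For [phi = f / F] and [F > 0] this is [rho |F grad (f / F)|^p], in a form that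
    needs no derivative of the quotient. *)
Definition remainder (phi : R) (x : V) : R :=
  rho x * enorm (hgrad G f x - phi *: hgrad G F x) `^ p.

Lemma remainder_ge0 phi x : 0 <= remainder phi x.
Proof. by rewrite mulr_ge0 ?powR_ge0. Qed.

Lemma measurable_remainder (phi : V -> R) : measurable_fun [set: V] phi ->
  measurable_fun [set: V] (fun x => remainder (phi x) x).
Proof.
move=> mphi; have mh w k : smooth w -> measurable_fun [set: V] (fun x => hgrad G w x 0 k).
  move=> sw; have [g [cg _ _]] := C1_gradient_hgrad k sw.
  exact: continuous_measurable_rV.
apply: measurable_funM; first exact: continuous_measurable_rV.
under eq_fun do rewrite enorm_powR.
suff ms : measurable_fun [set: V]
    (fun x => sqnorm (hgrad G f x - phi x *: hgrad G F x)).
  exact: (measurableT_comp (measurable_powR (p / 2)) ms).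
apply: measurable_sum => k; apply: measurable_funX.
have -> : (fun x => (hgrad G f x - phi x *: hgrad G F x) 0 k) =
    (fun x => hgrad G f x 0 k - phi x * hgrad G F x 0 k).
  by apply/funext => x; rewrite !mxE.
by apply: measurable_funB; [exact: mh|apply: measurable_funM => //; exact: mh].
Qed.

Lemma continuous_remainder x : continuous (remainder ^~ x).
Proof.
have p20 : 0 <= p / 2 by rewrite divr_ge0// ltW.
rewrite /remainder; under eq_fun do rewrite enorm_powR.
apply: continuous_mulr_fun; first exact: cst_continuous.
apply: continuous_powR => // [t|]; first exact: sqnorm_ge0.
have cl : continuous (fun t : R => hgrad G f x - t *: hgrad G F x).
  by move=> t; apply: cvgB; [exact: cvg_cst|apply: cvgZr_tmp; exact: cvg_id].
by under eq_fun do rewrite sqnorm_dotp; exact: (continuous_dotp cl cl).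
Qed.

Context (eta : V -> R)
  (meta : measurable_fun [set: V] eta) (eta0 : forall x, 0 <= eta x)
  (supersolution :
    {ae mu, forall x, eta x * F x `^ (p - 1) <= - sub_laplacian G p rho F x}).

Let C : R := 2 `^ (1 - p).
Let C0 : 0 <= C. Proof. exact: powR_ge0. Qed.

Definition regularized_density (e : R) (x : V) : R :=
  eta x * F x `^ (p - 1) * (`|f x| `^ p * (F x + e) `^ (1 - p)) +
  C * remainder (f x / (F x + e)) x.

Let mF : measurable_fun [set: V] F.
Proof. by apply: continuous_measurable_rV; have [] := CF. Qed.

Let mf : measurable_fun [set: V] f.
Proof. by apply: continuous_measurable_rV; have [] := Cf. Qed.

Let mfp : measurable_fun [set: V] (fun x => `|f x| `^ p).
Proof.
have mn : measurable_fun [set: V] (fun x => `|f x|).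
  exact: measurableT_comp (@normr_measurable R setT) mf.
exact: (measurableT_comp (measurable_powR p) mn).
Qed.

Lemma measurable_regularized_density (e : R) : 0 < e ->
  measurable_fun [set: V] (regularized_density e).
Proof.
move=> e0; have mFe : measurable_fun [set: V] (fun x => F x + e).
  exact: measurable_funD mF (measurable_cst _).
have mpow (g : V -> R) r : measurable_fun [set: V] g ->
    measurable_fun [set: V] (fun x => g x `^ r).
  by move=> mg; exact: (measurableT_comp (measurable_powR r) mg).
apply: measurable_funD; apply: measurable_funM.
- by apply: measurable_funM => //; exact: mpow.
- by apply: measurable_funM => //; exact: mpow.
- exact: measurable_cst.
- apply: measurable_remainder; apply: measurable_fun_div => // x.
  by rewrite ltW// ltr_wpDl.
Qed.

Lemma regularized_density_ge0 (e : R) x : 0 <= regularized_density e x.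
Proof.
apply: addr_ge0; first by rewrite !mulr_ge0 ?powR_ge0.
by rewrite mulr_ge0 ?remainder_ge0.
Qed.

(** The supersolution inequality times the test function, plus [rho] times
    Picone's inequality for [F + e], bounds the density by the energy density
    minus [tested_flux_div e]. *)
Lemma integral_regularized_density (e : R) : 0 < e ->
  (\int[mu]_x (regularized_density e x)%:E <=
   \int[mu]_x (rho x * enorm (hgrad G f x) `^ p)%:E)%E.
Proof.
move=> e0; have [it t0] := integral_tested_flux_div e0.
have Fe0 x : 0 < F x + e by rewrite ltr_wpDl.
apply: (integral_le_of_integral_eq0 _ _ integrable_energy it t0).
- exact: measurable_regularized_density.
- exact: regularized_density_ge0.
- apply: filterS supersolution => x /= super.
  rewrite /tested_flux_div /regularized_density /remainder.
  have T0 : 0 <= `|f x| `^ p * (F x + e) `^ (1 - p) by rewrite mulr_ge0 ?powR_ge0.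
  have combine (E T' L r A b H : R) : r * (A + C * b) <= r * H ->
      E * T' <= - L * T' -> E * T' + C * (r * b) <= r * H - (r * A + T' * L).
    by move=> *; lra.
  have h1 := ler_wpM2r T0 super.
  have h2 := ler_wpM2l (rho0 x)
    (picone (hgrad G F x) (hgrad G f x) (f x) p2 (Fe0 x)).
  exact: (combine _ _ _ _ _ _ _ h2 h1).
Qed.

(** The quotient [F x / F x] is the indicator of [F x != 0]: at a zero of [F] the
    factor [F] makes [F grad (f / F)] zero, whatever the derivative of [f / F]
    there. *)
Definition limit_density (x : V) : R :=
  eta x * `|f x| `^ p + C * (F x / F x * remainder (f x / F x) x).

Lemma cvg_regularized_density x : 0 < F x ->
  (fun n => regularized_density (harmonic n) x) @ \oo --> limit_density x.
Proof.
move=> Fx0; have -> : limit_density x = regularized_density 0 x.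
  rewrite /limit_density /regularized_density addr0 divff ?gt_eqF// mul1r.
  congr (_ + _); rewrite -mulrA; congr (_ * _).
  rewrite mulrCA -powRD ?(gt_eqF Fx0) ?implybT//.
  by rewrite (_ : p - 1 + (1 - p) = 0) ?powRr0 ?mulr1//; ring.
suff c : continuous_at (0 : R) (regularized_density ^~ x).
  exact: (cvg_comp (@harmonic R) (regularized_density ^~ x) (@cvg_harmonic R) c).
have cs : continuous_at (0 : R) (fun e : R => F x + e).
  exact: (cvgD (cvg_cst _) cvg_id).
have cp : continuous_at (0 : R) (fun e : R => (F x + e) `^ (1 - p)).
  apply: (@continuous_comp _ _ _ (fun e => F x + e) (fun t => t `^ (1 - p))) => //.
  rewrite addr0; apply/differentiable_continuous/derivable1_diffP.
  by have [] := is_derive1_powR (1 - p) Fx0.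
have cq : continuous_at (0 : R) (fun e : R => f x / (F x + e)).
  by apply: (cvgM (cvg_cst _) (cvgV _ cs)); rewrite addr0 gt_eqF.
have cr : continuous_at (0 : R) (fun e : R => remainder (f x / (F x + e)) x).
  exact: continuous_comp cq (@continuous_remainder x _).
exact: (cvgD (cvgM (cvg_cst _) (cvgM (cvg_cst _) cp)) (cvgM (cvg_cst _) cr)).
Qed.

Lemma limit_density_ge0 x : 0 <= limit_density x.
Proof.
apply: addr_ge0; first by rewrite mulr_ge0 ?powR_ge0.
by rewrite mulr_ge0// mulr_ge0 ?divr_ge0 ?remainder_ge0.
Qed.

Lemma measurable_limit_density :
  measurable_fun [set: V] (fun x => eta x * `|f x| `^ p) /\
  measurable_fun [set: V] (fun x => F x / F x * remainder (f x / F x) x).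
Proof.
split; first exact: measurable_funM.
apply: measurable_funM; first exact: measurable_fun_div.
by apply: measurable_remainder; exact: measurable_fun_div.
Qed.

Lemma integral_limit_density : {ae mu, forall x, 0 < F x} ->
  (\int[mu]_x (limit_density x)%:E <=
   \int[mu]_x (rho x * enorm (hgrad G f x) `^ p)%:E)%E.
Proof.
move=> Fpos.
apply: (integral_le_of_ae_cvg (h_ := fun n x => regularized_density (harmonic n) x)).
- by move=> n; apply: measurable_regularized_density; exact: harmonic_gt0.
- by move=> n x; exact: regularized_density_ge0.
- have [m1 m2] := measurable_limit_density; apply: measurable_funD => //.
  by apply: measurable_funM => //; exact: measurable_cst.
- exact: limit_density_ge0.
- by apply: filterS Fpos => x; exact: cvg_regularized_density.
- by move=> n; apply: integral_regularized_density; exact: harmonic_gt0.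
Qed.

End hardy.

Lemma hgrad_quotient (R : realType) (N : nat) (Ns : seq nat)
    (G : stratified_group R N Ns) (F f : 'rV[R]_(N + sumn Ns) -> R) gF gf x :
  C1_gradient F gF -> C1_gradient f gf -> F x != 0 ->
  F x *: hgrad G (fun y => f y / F y) x =
  hgrad G f x - (f x / F x) *: hgrad G F x.
Proof.
move=> CF Cf Fx0; have [_ _ dF] := CF; have [_ _ df] := Cf.
apply/rowP => k; rewrite !mxE.
rewrite (C1_gradient_derive _ _ CF) (C1_gradient_derive _ _ Cf).
set v := hfield G k x.
have [dFx DF] := dF x v.
have dV : is_derive x v (fun y => (F y)^-1) (- (F x) ^- 2 *: 'D_v F x).
  by split; [exact: derivableV|exact: deriveV].
have [_ D] := is_deriveM (df x v) dV.
rewrite [X in _ * X](_ : _ = 'D_v (f * (fun y => (F y)^-1)) x)//.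
by rewrite D DF /GRing.scale/=; field.
Qed.

Theorem theorem5p4 (R : realType) (p : R) (hp : 2 <= p) :
  exists C : R, 0 < C /\
  forall (N : nat) (Ns : seq nat) (G : stratified_group R N Ns)
    (rho F eta f : 'rV[R]_(N + sumn Ns) -> R),
    let mu := lebesgue_rV (N + sumn Ns) in
    Ck 1 rho -> (forall x, 0 <= rho x) ->
    smooth F -> (forall x, 0 <= F x) -> {ae mu, forall x, 0 < F x} ->
    loc_integrable eta -> {ae mu, forall x, 0 <= eta x} ->
    {ae mu, forall x, eta x * F x `^ (p - 1) <= - sub_laplacian G p rho F x} ->
    smooth f -> compactly_supported f ->
    ('N[mu]_(p%:E)[(fun x => (eta x `^ p^-1 * f x)%:E)] `^ p +
     C%:E * 'N[mu]_(p%:E)[(fun x =>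
       (enorm ((rho x `^ p^-1 * F x) *: hgrad G (fun y => f y / F y) x))%:E)] `^ p
     <= 'N[mu]_(p%:E)[(fun x =>
       (enorm (rho x `^ p^-1 *: hgrad G f x))%:E)] `^ p)%E.
Proof.
exists (2 `^ (1 - p)); split; first exact: powR_gt0.
move=> N Ns G rho F eta f mu Crho rho0 sF F0 Fpos [meta _] eta0 super sf cf.
have [M suppf] := compactly_supported_box cf.
have p0 : 0 < p by exact: lt_le_trans hp.
have pn0 : p != 0 by rewrite gt_eqF.
have rhop x : `|rho x `^ p^-1| `^ p = rho x.
  by rewrite ger0_norm ?powR_ge0// -powRrM mulVf// powRr1.
(* Truncated, since [eta] is nonnegative only almost everywhere. *)
pose eta' x := Num.max (eta x) 0.
have meta' : measurable_fun [set: 'rV[R]_(N + sumn Ns)] eta'.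
  exact: measurable_maxr meta (measurable_cst _).
have eta'0 x : 0 <= eta' x by rewrite le_max lexx orbT.
have etaE : {ae mu, forall x, eta' x = eta x}.
  by apply: filterS eta0 => x eta0; rewrite /eta' max_l.
have super' : {ae mu, forall x,
    eta' x * F x `^ (p - 1) <= - sub_laplacian G p rho F x}.
  by apply: filterS2 etaE super => x ->.
have [mA mB] := measurable_limit_density G p Crho sF F0 sf meta'.
have main := integral_limit_density hp Crho rho0 sF F0 sf suppf meta' eta'0 super' Fpos.
have E3 : ('N[mu]_(p%:E)[(fun x => (enorm (rho x `^ p^-1 *: hgrad G f x))%:E)] `^ p =
    \int[mu]_x (rho x * enorm (hgrad G f x) `^ p)%:E)%E.
  rewrite (powR_Lnorm _ _ pn0); apply: eq_integral => x _.
  rewrite abse_EFin poweR_EFin ger0_norm ?sqrtr_ge0//.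
  by rewrite enormZ powRM ?sqrtr_ge0// rhop.
have E1 : ('N[mu]_(p%:E)[(fun x => (eta x `^ p^-1 * f x)%:E)] `^ p =
    \int[mu]_x (eta' x * `|f x| `^ p)%:E)%E.
  have mf : measurable_fun [set: 'rV[R]_(N + sumn Ns)] f.
    by apply: continuous_measurable_rV; have [] := Ck1_C1_gradient (sf 1).
  have mg : measurable_fun [set: 'rV[R]_(N + sumn Ns)]
      (fun x => `|eta x `^ p^-1 * f x|).
    apply: (measurableT_comp (@normr_measurable R setT)).
    apply: measurable_funM => //.
    exact: (measurableT_comp (measurable_powR p^-1) meta).
  rewrite (powR_Lnorm _ _ pn0); apply: ge0_ae_eq_integral => //.
  - by apply/measurable_EFinP; exact: (measurableT_comp (measurable_powR p) mg).
  - exact/measurable_EFinP.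
  - by move=> x _; exact: poweR_ge0.
  - by move=> x _; rewrite lee_fin mulr_ge0 ?powR_ge0.
  - apply: filterS etaE => x etax _ /=.
    rewrite normrM powRM// -etax ger0_norm ?powR_ge0//.
    by rewrite -powRrM mulVf// powRr1.
have E2 : ('N[mu]_(p%:E)[(fun x => (enorm ((rho x `^ p^-1 * F x) *:
      hgrad G (fun y => f y / F y) x))%:E)] `^ p =
    \int[mu]_x (F x / F x * remainder G p rho F f (f x / F x) x)%:E)%E.
  rewrite (powR_Lnorm _ _ pn0); apply: eq_integral => x _.
  rewrite abse_EFin poweR_EFin ger0_norm ?sqrtr_ge0//.
  rewrite -scalerA enormZ powRM ?sqrtr_ge0// rhop.
  have [Fx0|Fx0] := eqVneq (F x) 0.
    rewrite Fx0 scale0r mul0r mul0r -(scale0r (0 : 'rV_N)) enormZ.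
    by rewrite normr0 mul0r powR0 ?mulr0.
  rewrite (hgrad_quotient _ (Ck1_C1_gradient (sF 1)) (Ck1_C1_gradient (sf 1)) Fx0).
  by rewrite divff// mul1r.
rewrite E1 E2 E3 -ge0_integralZl_EFin ?powR_ge0//; last 2 first.
- by move=> x _; rewrite lee_fin mulr_ge0 ?divr_ge0 ?remainder_ge0.
- exact/measurable_EFinP.
rewrite -ge0_integralD//.
- by move=> x _; rewrite lee_fin mulr_ge0 ?powR_ge0.
- exact/measurable_EFinP.
- move=> x _; rewrite -EFinM lee_fin mulr_ge0 ?powR_ge0// mulr_ge0 ?divr_ge0//.
  exact: remainder_ge0.
- apply/measurable_EFinP; apply: measurable_funM => //; exact: measurable_cst.
Qed.
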